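(* Let $\{(d_i,n_i,0),i\in\{1,\dots,I\}\}$ be a polyhedral ESP in $\mathbb{R}^J$ that has a conical domain $G$ with angle less than $\pi$ and has $\mathcal{V}=\{0\}$. Suppose there exist a compact, convex, symmetric set $B\subset\mathbb{R}^J$ with $0\in B^\circ$ and $\delta>0$ such that for every $i\in\{1,\dots,I\}$: if $z\in\partial B$ and $|\langle z,n_i\rangle|<\delta$, then $\langle\nu,d_i\rangle=0$ for every unit inward normal $\nu$ to $B$ at $z$. Then for any $R\in(0,\infty)$ there exist $L<\infty$ and a function $g\in\mathcal{C}^2(G^\circ\cup\mathcal{U})$, where $\mathcal{U}=\partial G\setminus\mathcal{V}$, satisfying the following properties. \begin{enumerate} \item $\mathrm{supp}[g]\subset N_R(\mathcal{V})$. \item There exist $\theta>0$ and $r\in(0,R)$ such that (a) $\langle\nabla g(x),d\rangle\ge0$ for $d\in d^1(x)$ and $x\in\mathcal{U}$; (b) $\langle\nabla g(x),d\rangle\ge\theta$ for $d\in d^1(x)$ and $x\in\mathcal{U}\cap N_r(\mathcal{V})$. \item $\sup_{x\in G^\circ\cup\mathcal{U}}|g(x)|\vee|\nabla g(x)|\le L$ and, for $x\in G^\circ\cup\mathcal{U}$, $$\frac12\sum_{i,j=1}^J\left|\frac{\partial^2g(x)}{\partial x_i\partial x_j}\right|\le\frac{L}{d(x,\mathcal{V})}.$$ \end{enumerate}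
   Context: $S_1(0)$ is the unit sphere of $\mathbb{R}^J$. Polyhedral ESP: a finite collection $(d_i,n_i,c_i)\in\mathbb{R}^J\times S_1(0)\times\mathbb{R}$ with $\langle d_i,n_i\rangle=1$; domain $G=\cap_i\{x:\langle x,n_i\rangle\ge c_i\}$ (the closure of a connected open set); $d(x)=\{0\}$ for $x\in G^\circ$ and $d(x)=\{\sum_{i\in I(x)}\alpha_id_i:\alpha_i\ge0\}$ for $x\in\partial G$, where $I(x)=\{i:\langle x,n_i\rangle=c_i\}$. Here all $c_i=0$, so $G$ is a convex polyhedral cone with vertex at the origin; ''angle less than $\pi$'' means that there is a unit vector $v\in G^\circ$ such that the maximal angle between $v$ and any $x\in\partial G\setminus\{0\}$ is less than $\pi/2$. $d^1(x)=d(x)\cap S_1(0)$; $\mathcal{V}=\{x\in\partial G:\exists\,d\in S_1(0)\text{ with }\{d,-d\}\subseteq d^1(x)\}$. Unit inward normals to $B$ at $z\in\partial B$ are the $\nu\in S_1(0)$ with $\langle\nu,x-z\rangle\ge0$ for all $x\in B$. Symmetric means $B=-B$. $d(x,A)$ is Euclidean distance to the set $A$ and $N_\delta(A)=\{y:d(y,A)\le\delta\}$. $\mathcal{C}^2(U)$ is the space of real functions twice continuously differentiable on some open set containing $U$; $\mathrm{supp}[g]$ is the support of $g$. *)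

(* Defs.v *)
From mathcomp Require Import all_boot all_order all_algebra.
From mathcomp Require Import all_classical all_reals all_analysis.

Set Implicit Arguments.
Unset Strict Implicit.
Unset Printing Implicit Defensive.

Import Order.TTheory GRing.Theory Num.Theory.
Import numFieldNormedType.Exports.

Local Open Scope classical_set_scope.
Local Open Scope ring_scope.

(* The norm that MathComp-Analysis puts on 'rV[R]_J is the sup norm: it induces
   the Euclidean topology, but the metric notions below are Euclidean and are
   therefore built on the inner product. *)

Definition dot {R : realType} {J : nat} (x y : 'rV[R]_J) : R :=
  \sum_(k < J) x 0 k * y 0 k.

Definition enorm {R : realType} {J : nat} (x : 'rV[R]_J) : R :=
  Num.sqrt (dot x x).

Definition unit_sphere {R : realType} {J : nat} : set 'rV[R]_J :=
  [set x | enorm x = 1].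

Definition angle {R : realType} {J : nat} (x y : 'rV[R]_J) : R :=
  acos (dot x y / (enorm x * enorm y)).

(* Real-valued [inf], hence 0 when [A] is empty. *)
Definition dist_set {R : realType} {J : nat} (x : 'rV[R]_J) (A : set 'rV[R]_J)
    : R :=
  inf [set enorm (x - a) | a in A].

Definition nbhd_set {R : realType} {J : nat} (e : R) (A : set 'rV[R]_J)
    : set 'rV[R]_J :=
  [set y | dist_set y A <= e].

Definition boundary {T : topologicalType} (A : set T) : set T :=
  closure A `\` interior A.

Section PolyhedralESP.
Context {R : realType} {J I : nat}.
Implicit Types (d n : 'I_I -> 'rV[R]_J) (c : 'I_I -> R) (x : 'rV[R]_J).

Definition polyhedron n c : set 'rV[R]_J :=
  [set x | forall i, c i <= dot x (n i)].

Definition polyhedral_ESP d n c : Prop :=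
  [/\ forall i, unit_sphere (n i),
      forall i, dot (d i) (n i) = 1 &
      exists O : set 'rV[R]_J,
        [/\ open O, connected O & polyhedron n c = closure O]].

Definition active n c x : pred 'I_I := fun i => dot x (n i) == c i.

(* Outside the polyhedron, where the paper leaves d(x) undefined, this set is
   empty. *)
Definition refl_dir d n c x : set 'rV[R]_J :=
  [set u | (interior (polyhedron n c) x /\ u = 0) \/
           (boundary (polyhedron n c) x /\
            exists2 a : 'I_I -> R, forall i, 0 <= a i &
              u = \sum_(i < I | active n c x i) a i *: d i)].

Definition unit_refl_dir d n c x : set 'rV[R]_J :=
  refl_dir d n c x `&` unit_sphere.

Definition V_set d n c : set 'rV[R]_J :=
  [set x | boundary (polyhedron n c) x /\
     exists2 u, unit_sphere u &
       unit_refl_dir d n c x u /\ unit_refl_dir d n c x (- u)].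

Definition U_set d n c : set 'rV[R]_J :=
  boundary (polyhedron n c) `\` V_set d n c.

End PolyhedralESP.

(* "The maximal angle between v and the points of bd G \ {0} is less than pi/2"
   is expressed by a uniform bound on these angles below pi/2. *)
Definition angle_lt_pi {R : realType} {J : nat} (G : set 'rV[R]_J) : Prop :=
  exists v : 'rV[R]_J, [/\ unit_sphere v, interior G v &
    exists2 a : R, a < pi / 2 &
      forall x, boundary G x -> x != 0 -> angle v x <= a].

Definition symmetric_set {R : realType} {J : nat} (B : set 'rV[R]_J) : Prop :=
  B = [set - x | x in B].

Definition unit_inward_normal {R : realType} {J : nat} (B : set 'rV[R]_J)
    (z : 'rV[R]_J) : set 'rV[R]_J :=
  [set nu | unit_sphere nu /\ forall x, B x -> 0 <= dot nu (x - z)].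

Definition partial {R : realType} {J : nat} (k : 'I_J) (g : 'rV[R]_J -> R)
    : 'rV[R]_J -> R :=
  fun x => 'D_(delta_mx 0 k) g x.

Definition grad {R : realType} {J : nat} (g : 'rV[R]_J -> R) (x : 'rV[R]_J)
    : 'rV[R]_J :=
  \row_k partial k g x.

(* C^2(A).  A function on an open set O containing A is represented by a total
   function, whose values outside O are irrelevant. *)
Definition C2_on {R : realType} {J : nat} (A : set 'rV[R]_J)
    (g : 'rV[R]_J -> R) : Prop :=
  exists O : set 'rV[R]_J, [/\ open O, A `<=` O &
    forall x, O x ->
      [/\ differentiable g x,
          forall k, differentiable (partial k g) x &
          forall k l, {for x, continuous (partial l (partial k g))}]].

Definition supp {R : realType} {J : nat} (g : 'rV[R]_J -> R)
    : set 'rV[R]_J :=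
  closure [set x | g x != 0].

(* Main.v *)
Require Import Defs.
From HB Require Import structures.
From mathcomp Require Import all_boot all_order all_algebra finmap.
From mathcomp Require Import all_classical all_reals all_analysis.
From mathcomp Require Import ring lra zify.

Set Implicit Arguments.
Unset Strict Implicit.
Unset Printing Implicit Defensive.

Import Order.TTheory GRing.Theory Num.Theory.
Import numFieldNormedType.Exports.

Local Open Scope classical_set_scope.
Local Open Scope ring_scope.

(** A function with the required properties is built from a single shell. Let
    [A] be the part of the boundary of the cone where the maximum norm is between
    [alpha] and [2 alpha]. If [f] is twice differentiable, vanishes near the
    vertex and far from it, has nonnegative derivative along [d i] on the whole
    hyperplane orthogonal to [n i], and a derivative at least [theta] along
    [d i] at the points of [A] on that hyperplane, then
      g x = sum over j of 2^-j f (2^j x)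
    solves the problem: every boundary point close to the vertex, other than the
    vertex itself, is sent into [A] by some dilation by [2^j], and all other
    terms only help; the terms scale like a function that is homogeneous of
    degree one, so that [g] and its gradient are bounded while the second
    derivatives are O(1/|x|) (lemmas [dsum_ge], [dsum_le], [dsum2_le],
    [dsum_partials]).

    To obtain [f], first fix [x] in [A]. Since [x] is not in V, the directions
    [d i] with [i] active at [x] admit no nontrivial vanishing combination with
    nonnegative coefficients, so that some [q] satisfies [<q, d i> >= 1] for all
    of them ([gordan_alternative], [pointed_cone_functional]). The set [B] takes
    care of localization: the hypothesis on its normals says that, in a slab
    around the hyperplane orthogonal to [n i], the set [B] is invariant under
    small translations along [d i] ([slab_invariance]), hence so is the distance
    [D] to [B] near [B]. Consequently
      max 0 (eps - D z + kap <z, q>)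
    is a Lipschitz bump that never decreases along [d i] in the slab and grows at
    rate [kap] where it is positive ([bump_origin]). A small copy of it is placed
    at [x]; there only the indices active at [x] matter, and all of their
    hyperplanes pass through [x] ([bump_at]). Compactness of [A] and summation
    give a Lipschitz function [psi] for the whole of [A] ([pushed_compact]).

    Finally [psi] is mollified. Averaging over short segments parallel to the
    coordinate axes, twice in each direction, makes a Lipschitz function twice
    differentiable ([smooth_approximation]). The inequalities satisfied by [psi]
    along [d i] hold on a neighbourhood of the hyperplane, so they pass to
    averages of translates of [psi], and from there to the derivatives
    ([pushed_smooth]). *)

(** * Lipschitz functions and antiderivatives *)

Definition lip {R : realType} {V : normedModType R} (K : R) (f : V -> R) :=
  forall x y, `|f x - f y| <= K * `|x - y|.

Section Lip.
Context {R : realType} {V : normedModType R}.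
Implicit Types f g : V -> R.

Lemma lip_sub K f x v : lip K f -> `|f (x + v) - f x| <= K * `|v|.
Proof. by move=> /(_ (x + v) x); rewrite [x + v]addrC addrK. Qed.

Lemma lip_le K K' f : K <= K' -> lip K f -> lip K' f.
Proof. by move=> KK' fK x y; rewrite (le_trans (fK x y))// ler_wpM2r. Qed.

Lemma lip_add K K' f g : lip K f -> lip K' g -> lip (K + K') (fun x => f x + g x).
Proof.
move=> fK gK x y; rewrite opprD addrACA (le_trans (ler_normD _ _))// mulrDl.
exact: lerD.
Qed.

Lemma lip_shift K f v : lip K f -> lip K (fun x => f (x + v)).
Proof. by move=> fK x y; have := fK (x + v) (y + v); rewrite opprD addrACA subrr addr0. Qed.

Lemma lip_opp K f : lip K f -> lip K (fun x => - f x).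
Proof. by move=> fK x y; rewrite -opprD normrN; exact: fK. Qed.

Lemma lip_continuous K f : lip K f -> continuous f.
Proof.
move=> fK x; apply/cvgrPdist_le => e e0.
have K0 : 0 < `|K| + 1 by rewrite ltr_wpDl.
near=> y; rewrite (le_trans (fK x y))//.
rewrite (@le_trans _ _ ((`|K| + 1) * `|x - y|))//.
  by rewrite ler_wpM2r// (le_trans (ler_norm K))// lerDl.
rewrite mulrC -ler_pdivlMr//; near: y.
by apply: (@cvgr_dist_le _ _ _ (nbhs x) _ idfun x) => //; rewrite divr_gt0.
Unshelve. all: by end_near. Qed.

End Lip.

Section Integral.
Context {R : realType}.
Local Notation mu := (@lebesgue_measure R).
Implicit Types (p q P : R -> R).

Lemma continuous_itv_integrable p a b : continuous p ->
  mu.-integrable `[a, b] (EFin \o p).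
Proof.
move=> cp; apply: continuous_compact_integrable; first exact: segment_compact.
exact: continuous_subspaceT.
Qed.

Lemma antiderivative p (M : R) : continuous p ->
  exists P, forall t, - M < t -> t < M -> is_derive t 1 P (p t).
Proof.
move=> cp; exists (fun t => \int[mu]_(s in `[- M, t]) p s)%R => t tM Mt.
have [dP P'] := @continuous_FTC1_closed R p (- M) t M Mt
  (continuous_itv_integrable _ _ cp) tM (cp t).
by apply: DeriveDef; [exact: dP|rewrite -derive1E; exact: P'].
Qed.

Lemma Rintegral_antiderivative p P (a b : R) : a < b -> continuous p ->
  (forall t, a <= t <= b -> is_derive t 1 P (p t)) ->
  (\int[mu]_(s in `[a, b]) p s)%R = P b - P a.
Proof.
move=> ab cp dP.
have cP t : a <= t <= b -> P x @[x --> t] --> P t.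
  move=> /dP tP; apply: differentiable_continuous; apply/derivable1_diffP.
  by case: tP.
rewrite /Rintegral (@continuous_FTC2 _ _ P)//.
- exact: continuous_subspaceT.
- split.
  + move=> t; rewrite in_itv/= => /andP[ta tb].
    by case: (dP t) => //; rewrite !ltW.
  + by apply: cvg_at_right_filter; apply: cP; rewrite lexx ltW.
  + by apply: cvg_at_left_filter; apply: cP; rewrite lexx ltW.
- move=> t; rewrite in_itv/= => /andP[ta tb].
  by rewrite derive1E; case: (dP t) => //; rewrite !ltW.
Qed.

(** The mean value theorem gives [P b - P a = (b - a) * p t] for an intermediate
    [t], and the Lipschitz bound replaces [p t] by [p a]. *)
Lemma antiderivative_taylor p P (K a b : R) : lip K p ->
  (forall t, Num.min a b <= t <= Num.max a b -> is_derive t 1 P (p t)) ->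
  `|P b - P a - (b - a) * p a| <= K * (b - a) ^+ 2.
Proof.
move=> pK.
have main (c d : R) : c <= d -> (forall t, c <= t <= d -> is_derive t 1 P (p t)) ->
    exists2 t, c <= t <= d & P d - P c = p t * (d - c).
  move=> cd dP; have [||t] := @MVT_segment R P p c d cd.
  - move=> t; rewrite in_itv/= => /andP[ta tb].
    by apply: dP; rewrite !ltW.
  - apply: derivable_within_continuous => t; rewrite in_itv/= => tcd.
    by case: (dP t).
  by rewrite in_itv/= => tcd ->; exists t.
have [ab|/ltW ba] := leP a b => dP.
- have [t /andP[t1 t2] ->] := main _ _ ab dP.
  rewrite mulrC -mulrBr normrM (le_trans (ler_wpM2l _ (pK _ _)))//.
  rewrite mulrCA expr2 ler_wpM2l//.
    by have := pK 0 1; rewrite sub0r normrN1 mulr1; apply: le_trans.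
  by rewrite !ger0_norm ?subr_ge0// ler_wpM2l ?subr_ge0// lerB.
- have [t /andP[t1 t2] e] := main _ _ ba dP.
  have -> : P b - P a = p t * (b - a) by rewrite -(opprB (P a)) e; ring.
  rewrite mulrC -mulrBr normrM (le_trans (ler_wpM2l _ (pK _ _)))//.
  rewrite mulrCA -real_normK ?num_real// expr2 ler_wpM2l//.
    by have := pK 0 1; rewrite sub0r normrN1 mulr1; apply: le_trans.
  rewrite ler_wpM2l// distrC [X in _ <= X]distrC.
  by rewrite !ger0_norm ?subr_ge0// lerB.
Qed.

End Integral.

(** * Averages over segments *)

Section Average.
Context {R : realType} {V : normedModType R}.
Local Notation mu := (@lebesgue_measure R).
Implicit Types (f g : V -> R) (v w x y : V).

Definition avg w f x : R := (\int[mu]_(s in `[0%R, 1%R]) f (x + s *: w))%R.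

Lemma lip_line K f x w : lip K f -> lip (K * `|w|) (fun s : R => f (x + s *: w)).
Proof.
move=> fK s t; rewrite (le_trans (fK _ _))//.
by rewrite opprD addrACA subrr add0r -scalerBl normrZ mulrAC -mulrA.
Qed.

Lemma avg_shift w f x v : avg w f (x + v) = avg w (fun z => f (z + v)) x.
Proof. by rewrite /avg; congr Rintegral; apply/funext => s; rewrite addrAC. Qed.

Lemma avg_lin K K' w f g c : lip K f -> lip K' g ->
  avg w (fun x => f x + c * g x) = fun x => avg w f x + c * avg w g x.
Proof.
move=> fK gK; apply/funext => x; rewrite /avg.
have cf := lip_continuous (lip_line x w fK).
have cg := lip_continuous (lip_line x w gK).
have cg' : continuous (fun s : R => c * g (x + s *: w)).
  by move=> s; apply: cvgM; [exact: cvg_cst|exact: cg].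
rewrite RintegralD//; [|exact: continuous_itv_integrable..].
by rewrite RintegralZl//; exact: continuous_itv_integrable.
Qed.

Lemma avg_le K K' w f g x : lip K f -> lip K' g ->
  (forall s, 0 <= s <= 1 -> f (x + s *: w) <= g (x + s *: w)) ->
  avg w f x <= avg w g x.
Proof.
move=> fK gK fg; have cf := lip_continuous (lip_line x w fK).
have cg := lip_continuous (lip_line x w gK).
by apply: le_Rintegral => //; exact: continuous_itv_integrable.
Qed.

Lemma lip_cst c : lip 0 (fun _ : V => c).
Proof. by move=> x y; rewrite subrr normr0 mul0r. Qed.

Lemma avg_cst w c x : avg w (fun=> c) x = c.
Proof.
rewrite /avg Rintegral_cst//= lebesgue_measure_itv/= lte_fin ltr01.
by rewrite sube0 /= mulr1.
Qed.

Lemma avg_norm_le K w f x C : lip K f ->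
  (forall z, `|f z| <= C) -> `|avg w f x| <= C.
Proof.
move=> fK fC; rewrite ler_norml -{1}(avg_cst w (- C) x) -{2}(avg_cst w C x).
apply/andP; split.
- by apply: (avg_le (lip_cst _) fK) => s _; have /[!ler_norml]/andP[] := fC (x + s *: w).
- by apply: (avg_le fK (lip_cst _)) => s _; have /[!ler_norml]/andP[] := fC (x + s *: w).
Qed.

Lemma avg_mono K K' w f g x y c : lip K f -> lip K' g ->
  (forall s, 0 <= s <= 1 -> f (x + s *: w) + c <= g (y + s *: w)) ->
  avg w f x + c <= avg w g y.
Proof.
move=> fK gK fg; rewrite -[y](subrKC x) avg_shift.
have <- : avg w (fun z => f z + c * 1) x = avg w f x + c.
  by rewrite (avg_lin _ _ fK (lip_cst 1)) avg_cst mulr1.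
apply: avg_le; [exact: lip_add fK (lip_cst (c * 1))|exact: lip_shift _ gK|].
move=> s s01; rewrite mulr1 (le_trans (fg _ s01))//.
by rewrite addrAC subrKC.
Qed.

Lemma lip_avg K w f : lip K f -> lip K (avg w f).
Proof.
move=> fK x y; have le z t : avg w f z <= avg w f t + K * `|z - t|.
  rewrite -lerBlDr; apply: avg_mono (fK) (fK) _ => s _.
  rewrite lerBlDr -lerBlDl (le_trans (ler_norm _))// (le_trans (fK _ _))//.
  by rewrite opprD addrACA subrr addr0.
by rewrite ler_distl lerBlDr le distrC le.
Qed.

(** Differentiability along [v] in a form with an error that is quadratic uniformly
    in the base point: averaging preserves it by linearity and monotonicity of the
    integral alone, with no theorem on differentiation under the integral sign. *)
Definition qder v f g :=
  exists C, forall x h, `|f (x + h *: v) - f x - h * g x| <= C * h ^+ 2.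

Lemma qder_avg K K' w v f g : lip K f -> lip K' g ->
  qder v f g -> qder v (avg w f) (avg w g).
Proof.
move=> fK gK [C fgC]; exists C => x h.
have l1 : lip (K + K) (fun z => f (z + h *: v) + (- 1) * f z).
  have := lip_add (lip_shift (h *: v) fK) (lip_opp fK).
  by congr lip; apply/funext => z; rewrite mulN1r.
have l2 : lip (`|h| * K') (fun z => - h * g z).
  by move=> z t; rewrite -mulrBr normrM normrN -mulrA ler_wpM2l.
have -> : avg w f (x + h *: v) - avg w f x - h * avg w g x =
   avg w (fun x => f (x + h *: v) + (- 1) * f x + (- h) * g x) x.
  rewrite (avg_lin _ _ l1 gK) (avg_lin _ _ (lip_shift _ fK) fK).
  by rewrite -avg_shift mulN1r mulNr.
by apply: (avg_norm_le _ _ (lip_add l1 l2)) => z; rewrite mulN1r mulNr.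
Qed.

(** Averaging over a segment gains one derivative along it: with [P] an
    antiderivative of [f] on the line through [x], the average at [x + h *: w] is
    [P (1 + h) - P h], whose derivative at [h = 0] is the increment of [f]. *)
Lemma qder_avg_self K w f : lip K f ->
  qder w (avg w f) (fun x => f (x + w) - f x).
Proof.
move=> fK; exists ((K * `|w|) + (K * `|w|)) => x h.
pose p s := f (x + s *: w); have pK : lip (K * `|w|) p := lip_line x w fK.
have [P dP] := @antiderivative R p (`|h| + 2) (lip_continuous pK).
have [hh hh'] : - `|h| <= h /\ h <= `|h|.
  by split; [rewrite lerNl -normrN ler_norm|exact: ler_norm].
have h0 := normr_ge0 h.
have -> : avg w f (x + h *: w) = P (1 + h) - P h.
  have cp : continuous (fun s => p (s + h)).
    move=> s; apply: (@continuous_comp _ _ _ (fun s => s + h) p).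
      by apply: cvgD; [exact: cvg_id|exact: cvg_cst].
    exact: lip_continuous pK _.
  suff dPh (s : R) : 0 <= s <= 1 -> is_derive s 1 (fun s => P (s + h)) (p (s + h)).
    have := Rintegral_antiderivative ltr01 cp dPh; rewrite add0r => <-.
    rewrite /avg; congr Rintegral; apply/funext => s.
    by rewrite /p -addrA -scalerDl [h + s]addrC.
  move=> /andP[s0 s1].
  have Ps : is_derive (s + h) 1 P (p (s + h)) by apply: dP; lra.
  have dh : is_derive s 1 (fun s => s + h) (1 : R).
    exact: is_derive_shift.
  have := @is_derive1_comp _ P (fun s => s + h) s _ _ Ps dh.
  by rewrite mulr1.
have -> : avg w f x = P 1 - P 0.
  apply: (Rintegral_antiderivative ltr01 (lip_continuous pK)).
  by move=> s /andP[s0 s1]; apply: dP; lra.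
have q1 : `|P (1 + h) - P 1 - (1 + h - 1) * p 1| <= K * `|w| * (1 + h - 1) ^+ 2.
  apply: (antiderivative_taylor pK) => t /andP[t1 t2]; apply: dP.
    by apply: lt_le_trans t1; rewrite lt_min; apply/andP; split; lra.
  by apply: le_lt_trans t2 _; rewrite gt_max; apply/andP; split; lra.
have q0 : `|P h - P 0 - (h - 0) * p 0| <= K * `|w| * (h - 0) ^+ 2.
  apply: (antiderivative_taylor pK) => t /andP[t1 t2]; apply: dP.
    by apply: lt_le_trans t1; rewrite lt_min; apply/andP; split; lra.
  by apply: le_lt_trans t2 _; rewrite gt_max; apply/andP; split; lra.
have e1 : 1 + h - 1 = h by ring.
have := lerD q1 q0; rewrite e1 subr0 => qq.
rewrite mulrDl; apply: le_trans qq.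
apply: (le_trans _ (ler_normB _ _)); rewrite le_eqVlt; apply/orP; left; apply/eqP.
by congr `|_|; rewrite /p scale1r scale0r addr0; ring.
Qed.

End Average.

Section Mollify.
Context {R : realType} {V : normedModType R}.
Implicit Types (f g : V -> R) (v w x y : V) (L : seq V).

Definition mollify L f := foldr avg f L.

Definition fdiff w f x := f (x + w) - f x.

Lemma lip_fdiff K w f : lip K f -> lip (K + K) (fdiff w f).
Proof. by move=> fK; apply: lip_add; [exact: lip_shift|exact: lip_opp]. Qed.

Lemma lip_mollify K L f : lip K f -> lip K (mollify L f).
Proof. by move=> fK; elim: L => //= w L IH; exact: lip_avg. Qed.

Lemma mollify_fdiff K L w f : lip K f ->
  mollify L (fdiff w f) = fdiff w (mollify L f).
Proof.
move=> fK; elim: L => //= v L ->; have mK := lip_mollify L fK.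
have -> : fdiff w (mollify L f) =
    (fun x => mollify L f (x + w) + (- 1) * mollify L f x).
  by apply/funext => x; rewrite mulN1r.
rewrite (avg_lin _ _ (lip_shift _ mK) mK); apply/funext => x.
by rewrite mulN1r -avg_shift.
Qed.

(** One occurrence of [w] in [L] is spent on the derivative along [w], and the
    result is again a mollification, of a finite difference of [f]. This is what
    makes the process iterable for higher derivatives. *)
Lemma qder_mollify K L w f : lip K f -> w \in L ->
  qder w (mollify L f) (mollify (rem w L) (fdiff w f)).
Proof.
move=> fK; elim: L => //= v L IH; rewrite inE.
have [<- _|/negPf vw] := eqVneq v w.
  rewrite (mollify_fdiff _ _ fK).
  exact: (qder_avg_self v (lip_mollify L fK)).
rewrite orFb => /IH; apply: qder_avg.
- exact: (lip_mollify _ fK).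
- exact: (lip_mollify _ (lip_fdiff _ fK)).
Qed.

(** The mollification at [x] only sees the points within [size L * h] of [x], so
    any inequality between values of [f] and [g] that survives all translations of
    that size passes to the mollifications. *)
Lemma mollify_mono K K' L f g (h : R) x y c : lip K f -> lip K' g -> 0 <= h ->
  (forall w, w \in L -> `|w| <= h) ->
  (forall u, `|u| <= (size L)%:R * h -> f (x + u) + c <= g (y + u)) ->
  mollify L f x + c <= mollify L g y.
Proof.
move=> fK gK h0; elim: L x y => [|w L IH] x y Lh fg /=.
  by have := fg 0; rewrite !addr0; apply; rewrite normr0 mul0r.
apply: (avg_mono (lip_mollify L fK) (lip_mollify L gK)) => s /andP[s0 s1].
apply: IH => [v vL|u uL]; first by apply: Lh; rewrite inE vL orbT.
rewrite -!addrA; apply: fg; rewrite /= -natr1 mulrDl mul1r addrC.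
rewrite (le_trans (ler_normD _ _))// lerD// normrZ ger0_norm//.
by rewrite (le_trans (ler_piMl _ s1))// Lh// mem_head.
Qed.

Lemma mollify_eq0 K L f (h : R) x : lip K f -> 0 <= h ->
  (forall w, w \in L -> `|w| <= h) ->
  (forall u, `|u| <= (size L)%:R * h -> f (x + u) = 0) -> mollify L f x = 0.
Proof.
move=> fK h0 Lh f0; have z : mollify L (fun=> 0) x = 0.
  by elim: (L) x {Lh f0} => //= w L' IH x; rewrite -[RHS](avg_cst w 0 x);
    congr avg; apply/funext.
have le0 : mollify L f x + 0 <= mollify L (fun=> 0) x.
  by apply: (mollify_mono fK (lip_cst 0) h0 Lh) => u /f0 ->; rewrite addr0.
have ge0 : mollify L (fun=> 0) x + 0 <= mollify L f x.
  by apply: (mollify_mono (lip_cst 0) fK h0 Lh) => u /f0 ->; rewrite addr0.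
by apply/eqP; rewrite eq_le; move: le0 ge0; rewrite z !addr0 => -> ->.
Qed.

End Mollify.

(** * The Euclidean and sup norms, and differentiability from quadratic expansions *)

Section RowVectors.
Context {R : realType} {J : nat}.
Implicit Types (u v x y : 'rV[R]_J).

Lemma coord_le_norm v k : `|v 0 k| <= `|v|.
Proof.
rewrite [leRHS]/Num.norm /= mx_normrE; apply/bigmax_geP; right => /=.
by exists (0, k).
Qed.

Lemma norm_le_coord v (c : R) : 0 <= c -> (forall k, `|v 0 k| <= c) -> `|v| <= c.
Proof.
move=> c0 vc; rewrite [leLHS]/Num.norm /= mx_normrE; apply/bigmax_leP; split => //=.
by move=> [i k] _ /=; rewrite ord1.
Qed.

Lemma norm_delta_le1 k : `|delta_mx 0 k : 'rV[R]_J| <= 1.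
Proof.
apply: norm_le_coord => // l; rewrite mxE eqxx /=.
by case: (l == k); rewrite ?normr1 ?normr0.
Qed.

Lemma dotDl u v x : dot (u + v) x = dot u x + dot v x.
Proof.
by rewrite /dot -big_split; apply: eq_bigr => k _ /=; rewrite mxE mulrDl.
Qed.

Lemma dotZl c v x : dot (c *: v) x = c * dot v x.
Proof. by rewrite /dot mulr_sumr; apply: eq_bigr => k _; rewrite mxE mulrA. Qed.

Lemma dotC u v : dot u v = dot v u.
Proof. by apply: eq_bigr => k _; rewrite mulrC. Qed.

Lemma dotDr u v x : dot x (u + v) = dot x u + dot x v.
Proof. by rewrite dotC dotDl !(dotC x). Qed.

Lemma dotZr c v x : dot x (c *: v) = c * dot x v.
Proof. by rewrite dotC dotZl (dotC x). Qed.

Lemma dotNl u x : dot (- u) x = - dot u x.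
Proof. by rewrite -scaleN1r dotZl mulN1r. Qed.

Lemma dotNr u x : dot x (- u) = - dot x u.
Proof. by rewrite dotC dotNl (dotC x). Qed.

Lemma dot0l x : dot 0 x = 0.
Proof. by rewrite -(scale0r x) dotZl mul0r. Qed.

Lemma dot0r x : dot x 0 = 0.
Proof. by rewrite dotC dot0l. Qed.

Lemma dot_sumr (S : finType) (P : pred S) (a : S -> 'rV[R]_J) x :
  dot x (\sum_(i | P i) a i) = \sum_(i | P i) dot x (a i).
Proof.
elim/big_rec2 : _ => [|i y z _ <-]; [exact: dot0r|exact: dotDr].
Qed.

Lemma dot_le u v : `|dot u v| <= J%:R * `|u| * `|v|.
Proof.
rewrite /dot (le_trans (ler_norm_sum _ _ _))//.
apply: (@le_trans _ _ (\sum_(k < J) `|u| * `|v|)).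
  by apply: ler_sum => k _; rewrite normrM ler_pM// coord_le_norm.
by rewrite sumr_const card_ord -mulrA mulr_natl.
Qed.

Lemma dot_ge0 v : 0 <= dot v v.
Proof. by apply: sumr_ge0 => k _; rewrite -expr2 sqr_ge0. Qed.

Lemma enorm_sqr v : enorm v ^+ 2 = dot v v.
Proof. by rewrite sqr_sqrtr// dot_ge0. Qed.

Lemma norm_le_enorm v : `|v| <= enorm v.
Proof.
apply: norm_le_coord => [|k]; first exact: sqrtr_ge0.
rewrite -sqrtr_sqr ler_wsqrtr// /dot (bigD1 k)//= -expr2 lerDl.
by apply: sumr_ge0 => l _; rewrite -expr2 sqr_ge0.
Qed.

Lemma enorm_le_norm v : enorm v <= J%:R * `|v|.
Proof.
rewrite -(@ler_pXn2r _ 2)// ?nnegrE ?sqrtr_ge0 ?mulr_ge0//.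
rewrite enorm_sqr (le_trans (ler_norm _))// (le_trans (dot_le _ _))//.
rewrite exprMn -mulrA -expr2 ler_wpM2r ?sqr_ge0// -natrX ler_nat.
by case: (J) => // m; rewrite leq_pmulr.
Qed.

Lemma enorm_eq0 v : enorm v = 0 -> v = 0.
Proof.
by move=> v0; apply/eqP; rewrite -normr_le0 -v0 norm_le_enorm.
Qed.

Lemma enormZ c v : enorm (c *: v) = `|c| * enorm v.
Proof.
rewrite /enorm dotZl dotZr mulrA -expr2 sqrtrM ?sqr_ge0//.
by rewrite sqrtr_sqr.
Qed.

Lemma sqr_dist_continuous w : continuous (fun x => dot (w - x) (w - x)).
Proof.
rewrite /dot; apply: continuous_big => [|k _ x]; first exact: add_continuous.
have c : continuous (fun y => (w - y) 0 k).
  apply: (@lip_continuous _ _ 1) => y z.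
  have -> : (w - y) 0 k - (w - z) 0 k = (z - y) 0 k by rewrite !mxE; ring.
  by rewrite mul1r distrC coord_le_norm.
exact: (cvgM (c x) (c x)).
Qed.

End RowVectors.

Section Calculus.
Context {R : realType} {J : nat}.
Local Notation V := 'rV[R]_J.
Implicit Types (f : V -> R) (F : 'I_J -> V -> R) (x v : V).

Definition lform (a : 'I_J -> R) v : R := \sum_k v 0 k * a k.

Lemma lform_linear a : linear (lform a : V -> R).
Proof.
move=> c u v; rewrite /lform /GRing.scale /= mulr_sumr -big_split.
by apply: eq_bigr => k _ /=; rewrite !mxE mulrDl mulrA.
Qed.

HB.instance Definition _ a :=
  GRing.isLinear.Build R V R *:%R (lform a) (lform_linear a).

Lemma lform_delta a k : lform a (delta_mx 0 k) = a k.
Proof.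
rewrite /lform (bigD1 k)//= mxE !eqxx mul1r big1 ?addr0// => l lk.
by rewrite mxE eqxx /= (negPf lk) mul0r.
Qed.

Lemma lform_dot a v : lform a v = dot (\row_k a k) v.
Proof. by apply: eq_bigr => k _; rewrite mxE mulrC. Qed.

Lemma lform_le a v : `|lform a v| <= (\sum_k `|a k|) * `|v|.
Proof.
rewrite (le_trans (ler_norm_sum _ _ _))// mulr_suml ler_sum// => k _.
by rewrite normrM mulrC ler_wpM2l// coord_le_norm.
Qed.

Lemma lform_continuous a : continuous (lform a : V -> R).
Proof.
apply: (@lip_continuous _ _ (\sum_k `|a k|)) => x y.
by rewrite -raddfB lform_le.
Qed.

Definition qdiff_at f (a : 'I_J -> R) x :=
  exists C : R, \forall v \near nbhs (0 : V), `|f (x + v) - f x - lform a v| <= C * `|v| ^+ 2.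

Lemma qdiff_at_littleo f a x : qdiff_at f a x ->
  (f \o shift x : V -> R) = cst (f x) + lform a +o_ (0 : V) (id : V -> V).
Proof.
move=> [C fC]; apply/eqaddoP => e e0; near=> v.
have -> : (f \o shift x - (cst (f x) + lform a)) v = f (x + v) - f x - lform a v.
  by rewrite /= !fctE /= opprD addrA [x + v]addrC.
have fv : `|f (x + v) - f x - lform a v| <= C * `|v| ^+ 2 by near: v.
rewrite (le_trans fv)// expr2 mulrA ler_wpM2r//.
rewrite (@le_trans _ _ ((`|C| + 1) * `|v|))//.
  by rewrite ler_wpM2r// (le_trans (ler_norm C))// lerDl.
rewrite mulrC -ler_pdivlMr ?ltr_wpDl//; near: v.
by apply: (@nbhs0_le _ V); rewrite divr_gt0// ltr_wpDl.
Unshelve. all: by end_near. Qed.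

Lemma qdiff_at_differentiable f a x : qdiff_at f a x ->
  differentiable f x /\ forall v, 'D_v f x = lform a v.
Proof.
move=> /qdiff_at_littleo fa.
have dE := diff_unique (@lform_continuous a) fa.
have df : differentiable f x.
  by apply/diff_locallyP; rewrite dE; split => //; exact: lform_continuous.
by split => // v; rewrite deriveE// dE.
Qed.

Lemma qdiff_at_partial f a x k : qdiff_at f a x -> partial k f x = a k.
Proof. by move=> /qdiff_at_differentiable[_ df]; rewrite /partial df lform_delta. Qed.

Definition qdiff f F := exists C, forall x v,
  `|f (x + v) - f x - lform (F ^~ x) v| <= C * `|v| ^+ 2.

Lemma qdiffW f F x : qdiff f F -> qdiff_at f (F ^~ x) x.
Proof. by move=> [C fC]; exists C; near=> v; exact: fC. Unshelve. all: by end_near. Qed.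

(** The increment of [f] is telescoped along the coordinate directions; moving
    the base point of each partial derivative back to [x] costs a Lipschitz term
    times a coordinate of [v], which is again quadratic. *)
Lemma qdiff_of_partials K f F : (forall k, lip K (F k)) ->
  (forall k, qder (delta_mx 0 k) f (F k)) -> qdiff f F.
Proof.
move=> FK fF.
have tele (l : seq 'I_J) : exists C, forall x v,
    `|f (x + \sum_(k <- l) v 0 k *: delta_mx 0 k) - f x
      - \sum_(k <- l) v 0 k * F k x| <= C * `|v| ^+ 2.
  elim: l => [|k l [C IH]].
    by exists 0 => x v; rewrite !big_nil addr0 !subrr normr0 mul0r.
  have [D fD] := fF k; exists (`|D| + `|K| * (size l)%:R + C) => x v.
  rewrite !big_cons; set u := \sum_(_ <- _) _ *: _; set p := \sum_(_ <- _) _ * _.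
  have uv : `|u| <= (size l)%:R * `|v|.
    rewrite /u; elim: (l) => [|m l' IHl]; first by rewrite big_nil normr0 mul0r.
    rewrite big_cons -natr1 mulrDl mul1r addrC (le_trans (ler_normD _ _))//.
    rewrite lerD// normrZ -[leRHS]mulr1 ler_pM// ?coord_le_norm//.
    exact: norm_delta_le1.
  have -> : f (x + (v 0 k *: delta_mx 0 k + u)) - f x - (v 0 k * F k x + p) =
    (f (x + u + v 0 k *: delta_mx 0 k) - f (x + u) - v 0 k * F k (x + u))
    + v 0 k * (F k (x + u) - F k x) + (f (x + u) - f x - p).
    by rewrite addrA addrAC; ring.
  rewrite (le_trans (ler_normD _ _))// mulrDl lerD ?IH//.
  rewrite (le_trans (ler_normD _ _))// mulrDl lerD//.
    rewrite (le_trans (fD _ _))// -[v 0 k ^+ 2]real_normK ?num_real//.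
    apply: (@le_trans _ _ (`|D| * `|v 0 k| ^+ 2)).
      by rewrite ler_wpM2r ?sqr_ge0// ler_norm.
    by rewrite ler_wpM2l// ler_pXn2r ?nnegrE// coord_le_norm.
  rewrite normrM expr2 mulrA mulrC ler_pM// ?coord_le_norm//.
  rewrite (le_trans (lip_sub _ _ (FK k)))// -mulrA.
  by rewrite (le_trans (ler_wpM2r _ (ler_norm K)))// ler_wpM2l.
have [C fC] := tele (index_enum 'I_J); exists C => x v.
have := fC x v; rewrite -[\sum_(k <- _) _ *: _]/(\sum_k v 0 k *: delta_mx 0 k).
by rewrite -row_sum_delta.
Qed.

Lemma qder_scale v f g (c : R) : qder v f g ->
  qder v (fun x => c * f x) (fun x => c * g x).
Proof.
move=> [C fC]; exists (`|c| * C) => x h.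
by rewrite (mulrCA h) -!mulrBr normrM -mulrA ler_wpM2l.
Qed.

Lemma qder_direction v f g (c : R) : c != 0 -> qder (c *: v) f g ->
  qder v f (fun x => c^-1 * g x).
Proof.
move=> c0 [C fC]; exists (C * c^-1 ^+ 2) => x h.
have := fC x (h / c); rewrite scalerA divfK// exprMn.
by rewrite -[h / c * _]mulrA -mulrA (mulrC (h ^+ 2)).
Qed.

End Calculus.

(** * Mollification of Lipschitz functions *)

Section SmoothApproximation.
Context {R : realType} {J : nat}.
Local Notation V := 'rV[R]_J.
Implicit Types (f : V -> R).

(** A twice differentiable function carried together with its derivatives, all
    globally Lipschitz and with uniform expansions: dilations and sums then act on
    the whole package, and no derivative has to be recomputed as a limit. *)
Record jet2 f (F1 : 'I_J -> V -> R) (F2 : 'I_J -> 'I_J -> V -> R) : Prop := Jet2 {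
  jet2_lip0 : exists K, lip K f;
  jet2_lip1 : exists K, forall k, lip K (F1 k);
  jet2_lip2 : exists K, forall k l, lip K (F2 k l);
  jet2_diff1 : qdiff f F1;
  jet2_diff2 : forall k, qdiff (F1 k) (F2 k) }.

Lemma lip_scale K f (c : R) : lip K f -> lip (`|c| * K) (fun x => c * f x).
Proof. by move=> fK x y; rewrite -mulrBr normrM -mulrA ler_wpM2l. Qed.

(** Mollification along segments of length [h] parallel to the axes, each used
    twice: one copy is consumed by each of the two differentiations, so that all
    second derivatives are still averages of finite differences of [f], hence
    Lipschitz. The total displacement is kept below [rho]. *)
Lemma smooth_approximation K f rho : lip K f -> 0 < rho ->
  exists f1 F1 F2,
    [/\ jet2 f1 F1 F2,
        forall x y c, (forall u, `|u| <= rho -> f (x + u) + c <= f (y + u)) ->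
          f1 x + c <= f1 y &
        forall x, (forall u, `|u| <= rho -> f (x + u) = 0) ->
          [/\ f1 x = 0, forall k, F1 k x = 0 & forall k l, F2 k l x = 0]].
Proof.
move=> fK rho0; pose h := rho / (J + J).+1%:R.
have h0 : 0 < h by rewrite divr_gt0.
have hn0 : h != 0 by rewrite gt_eqF.
pose w k : V := h *: delta_mx 0 k.
pose E := [seq w k | k <- enum 'I_J]; pose L := E ++ E.
have szL : size L = (J + J)%N by rewrite size_cat size_map size_enum_ord.
have wh u : u \in L -> `|u| <= h.
  rewrite mem_cat orbb => /mapP[k _ ->]; rewrite normrZ gtr0_norm//.
  by rewrite ler_piMr ?norm_delta_le1// ltW.
have wE k : w k \in E by rewrite map_f// mem_enum.
have wL k : w k \in L by rewrite mem_cat wE.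
(* Both derivatives may be taken in the same direction, hence the second copy. *)
have wL2 k l : w l \in rem (w k) L.
  have [->|ne] := eqVneq (w l) (w k); last by rewrite rem_mem.
  have /permP/(_ (pred1 (w k))) := perm_to_rem (wL k).
  rewrite count_cat /= eqxx add1n -has_pred1 has_count.
  have := wE k; rewrite -has_pred1 has_count.
  by case: (count_mem _ E) => [|n] //; rewrite addSn addnS; case: (count_mem _ _).
have hL n : (n <= J + J)%N -> n%:R * h <= rho.
  move=> nJ; rewrite /h mulrCA ler_piMr ?(ltW rho0)// ler_pdivrMr// mul1r.
  by rewrite ler_nat ltnW.
pose F1 k x := h^-1 * mollify (rem (w k) L) (fdiff (w k) f) x.
pose F2 k l x := h^-1 * (h^-1 *
  mollify (rem (w l) (rem (w k) L)) (fdiff (w l) (fdiff (w k) f)) x).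
have l1 k : lip (`|h^-1| * (K + K)) (F1 k).
  by apply: lip_scale; apply: lip_mollify; exact: lip_fdiff.
have l2 k l : lip (`|h^-1| * (`|h^-1| * (K + K + (K + K)))) (F2 k l).
  apply: lip_scale; apply: lip_scale; apply: lip_mollify.
  by apply: lip_fdiff; exact: lip_fdiff.
exists (mollify L f), F1, F2; split.
- split.
  + by exists K; exact: lip_mollify.
  + by exists (`|h^-1| * (K + K)).
  + by exists (`|h^-1| * (`|h^-1| * (K + K + (K + K)))).
  + apply: qdiff_of_partials l1 _ => k; apply: qder_direction hn0 _.
    exact: qder_mollify (wL k).
  + move=> k; apply: qdiff_of_partials (l2 k) _ => l; apply: qder_scale.
    by apply: qder_direction hn0 _; exact: (qder_mollify (lip_fdiff _ fK) (wL2 k l)).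
- move=> x y c fxy; apply: (mollify_mono fK fK (ltW h0) wh) => u.
  by rewrite szL => /le_trans/(_ (hL _ (leqnn _))); exact: fxy.
- move=> x fx; split.
  + apply: (mollify_eq0 fK (ltW h0) wh) => u.
    by rewrite szL => /le_trans/(_ (hL _ (leqnn _))); exact: fx.
  + move=> k; rewrite /F1 (mollify_eq0 (lip_fdiff _ fK) (ltW h0)) ?mulr0//.
      by move=> u /mem_rem; exact: wh.
    move=> u; rewrite size_rem// szL => uh.
    have J0 := leq_ltn_trans (leq0n k) (ltn_ord k).
    rewrite /fdiff -addrA !fx ?subrr//.
      by rewrite (le_trans uh)// hL// leq_pred.
    rewrite (le_trans (ler_normD _ _))// (le_trans (lerD uh (wh _ (wL k))))//.
    by rewrite -[X in _ + X]mul1r -mulrDl natr1 prednK ?addn_gt0 ?J0// hL.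
  + move=> k l; rewrite /F2 (mollify_eq0 (lip_fdiff _ (lip_fdiff _ fK)) (ltW h0)) ?mulr0//.
      by move=> u /mem_rem/mem_rem; exact: wh.
    move=> u; rewrite !size_rem// szL => uh.
    have J0 := leq_ltn_trans (leq0n k) (ltn_ord k).
    have uh1 : `|u| + h + h <= rho.
      rewrite (le_trans (lerD (lerD uh (lexx h)) (lexx h)))//.
      rewrite -addrA -[X in _ + (X + X)]mul1r -!mulrDl -[1 + 1]/(2%:R) -natrD hL//.
      lia.
    have hh (a b : R) : `|u| + a + b <= rho -> 0 <= b -> `|u| + a <= rho.
      by move=> ab b0; rewrite (le_trans _ ab)// lerDl.
    have uh2 := hh _ _ uh1 (ltW h0).
    have uh3 : `|u| <= rho by rewrite (le_trans _ uh2)// lerDl ltW.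
    have W m (v : V) (t : R) : `|v| + h <= t -> `|v + w m| <= t.
      by apply: le_trans; rewrite (le_trans (ler_normD _ _))// lerD2l wh.
    have -> : fdiff (w l) (fdiff (w k) f) (x + u) =
        f (x + (u + w l + w k)) - f (x + (u + w l)) - (f (x + (u + w k)) - f (x + u)).
      by rewrite /fdiff !addrA.
    rewrite !fx ?subrr//; try exact: W.
    by apply: (W k); rewrite (le_trans _ uh1)// lerD2r; exact: (W l).
Qed.

End SmoothApproximation.

(** * Sums over dyadic scales *)

Section DyadicSum.
Context {R : realType} {J : nat}.
Local Notation V := 'rV[R]_J.
Implicit Types (f g : V -> R) (F : 'I_J -> V -> R) (x y v : V) (b c t : R).

(** Dividing the increment by [t] and letting [t] tend to 0, with the choice of [t]
    made explicit from the quadratic error. *)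
Lemma qdiff_ge f F x v (theta tau : R) : qdiff f F -> 0 < tau ->
  (forall t, 0 <= t <= tau -> f x + t * theta <= f (x + t *: v)) ->
  theta <= lform (F ^~ x) v.
Proof.
move=> [C fC] tau0 fv; apply/ler_addgt0Pr => e e0.
pose D := `|C| * `|v| ^+ 2 + 1; have D0 : 0 < D by rewrite ltr_wpDl// mulr_ge0.
pose t := Num.min tau (e / D).
have t0 : 0 < t by rewrite lt_min tau0 divr_gt0.
have tt : t <= tau by rewrite ge_min lexx.
have tD : t * D <= e by rewrite -ler_pdivlMr// ge_min lexx orbT.
have := fv t; rewrite (ltW t0) tt => /(_ isT) fvt.
have := le_trans (ler_norm _) (fC x (t *: v)).
rewrite linearZ /= normrZ gtr0_norm// exprMn => Cv.
have Ct : C * (t ^+ 2 * `|v| ^+ 2) <= t * (t * D).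
  rewrite mulrCA expr2 -!mulrA ler_wpM2l ?(ltW t0)// ler_wpM2l ?(ltW t0)//.
  by rewrite (le_trans (ler_wpM2r _ (ler_norm C))) ?sqr_ge0// lerDl.
have tte : t * (t * D) <= t * e by rewrite ler_wpM2l// ltW.
rewrite -(ler_pM2l t0) mulrDr; move: Cv; rewrite /GRing.scale /=; lra.
Qed.

Lemma qdiff_add f g F (G : 'I_J -> V -> R) : qdiff f F -> qdiff g G ->
  qdiff (fun x => f x + g x) (fun k x => F k x + G k x).
Proof.
move=> [C fC] [D gD]; exists (C + D) => x v.
have -> : lform (fun k => F k x + G k x) v = lform (F ^~ x) v + lform (G ^~ x) v.
  by rewrite /lform -big_split; apply: eq_bigr => k _; rewrite mulrDr.
rewrite mulrDl (le_trans _ (lerD (fC x v) (gD x v)))//.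
rewrite (le_trans _ (ler_normD _ _))// le_eqVlt; apply/orP; left; apply/eqP.
by congr `|_|; ring.
Qed.

Lemma qdiff_dilate f F c t : qdiff f F ->
  qdiff (fun x => c * f (t *: x)) (fun k x => c * t * F k (t *: x)).
Proof.
move=> [C fC]; exists (`|c| * (C * `|t| ^+ 2)) => x v.
have -> : lform (fun k => c * t * F k (t *: x)) v =
    c * lform (F ^~ (t *: x)) (t *: v).
  rewrite /lform mulr_sumr; apply: eq_bigr => k _; rewrite mxE; ring.
rewrite scalerDr -!mulrBr normrM -mulrA ler_wpM2l// (le_trans (fC _ _))//.
by rewrite normrZ exprMn mulrA.
Qed.

Definition dpart c f (N : nat) x : R := \sum_(j < N) c ^+ j * f (2 ^+ j *: x).

(** Differentiating [f (2 ^+ j *: x)] brings out a factor [2 ^+ j], so the ratio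
    [c] of the sum doubles at each derivative. *)
Lemma qdiff_dpart c f F N : qdiff f F ->
  qdiff (dpart c f N) (fun k => dpart (2 * c) (F k) N).
Proof.
move=> fF; elim: N => [|N IH].
  exists 0 => x v; rewrite /dpart !big_ord0 subrr sub0r normrN mul0r.
  by rewrite /lform big1 ?normr0// => k _; rewrite big_ord0 mulr0.
have := qdiff_add IH (qdiff_dilate (c ^+ N) (2 ^+ N) fF).
congr qdiff; first by apply/funext => x; rewrite /dpart big_ord_recr.
apply/funext => k; apply/funext => x; rewrite /dpart big_ord_recr /=.
by rewrite exprMn (mulrC (2 ^+ N)).
Qed.

Lemma lip_dpart K c f N : lip K f ->
  exists K', lip K' (dpart c f N).
Proof.
move=> fK; elim: N => [|N [K' IH]].
  by exists 0 => x y; rewrite /dpart !big_ord0 subrr normr0 mul0r.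
have l : lip (`|c ^+ N| * (K * `|2 ^+ N|)) (fun x => c ^+ N * f (2 ^+ N *: x)).
  apply: lip_scale => x y; rewrite (le_trans (fK _ _))//.
  by rewrite -scalerBr normrZ mulrA.
have := lip_add IH l; set K'' := K' + _ => l''; exists K''.
by congr lip : l''; apply/funext => x; rewrite /dpart big_ord_recr.
Qed.

Lemma lform_dpart c F N x v : lform (fun k => dpart c (F k) N x) v =
  dpart c (fun z => lform (F ^~ z) v) N x.
Proof.
rewrite /lform /dpart; under eq_bigr do rewrite mulr_sumr.
rewrite exchange_big; apply: eq_bigr => j _; rewrite mulr_sumr.
by apply: eq_bigr => k _; rewrite mulrCA.
Qed.

(** For [f] vanishing outside the ball of radius [b], the sum of [c ^+ j * f (2 ^+ j *: x)]
    over all [j]: since [n < 2 ^ n], every index from the truncation on contributes 0.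
    With [c = 2^-1] this behaves like a function homogeneous of degree one, and
    [c = 1], [c = 2] give its first and second derivatives. *)
Definition dsum b c f x : R := dpart c f (Num.bound (b / `|x|)) x.

Definition supported b f := forall z, b <= `|z| -> f z = 0.

Lemma dpart_stable b c f x N M : supported b f -> b <= 2 ^+ N * `|x| ->
  (N <= M)%N -> dpart c f M x = dpart c f N x.
Proof.
move=> fb bN NM; rewrite /dpart -!(big_mkord xpredT (fun j => c ^+ j * f (2 ^+ j *: x))).
rewrite (big_cat_nat _ NM)//= [X in _ + X](_ : _ = 0) ?addr0//.
rewrite big_nat big1// => j /andP[Nj _].
rewrite fb ?mulr0// (le_trans bN)// normrZ ger0_norm ?exprn_ge0//.
by rewrite ler_wpM2r// ler_weXn2l// ler1n.
Qed.

Lemma dsumE b c f x N : supported b f -> 0 < b -> b <= 2 ^+ N * `|x| ->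
  dsum b c f x = dpart c f N x.
Proof.
move=> fb b0 bN; have x0 : 0 < `|x|.
  rewrite lt_neqAle eq_sym normr_ge0 andbT; apply/eqP => x0.
  by move: bN; rewrite x0 mulr0 leNgt b0.
rewrite /dsum; set M := Num.bound _.
have bM : b <= 2 ^+ M * `|x|.
  rewrite -ler_pdivrMr// ltW// (lt_le_trans (archi_boundP _)) ?divr_ge0 ?(ltW b0)//.
  by rewrite -natrX ler_nat ltnW// ltn_expl.
have [NM|/ltnW MN] := leqP N M; first exact: (dpart_stable _ fb bN NM).
by apply/esym; exact: (dpart_stable _ fb bM MN).
Qed.

Lemma dsum_outside b c f x : supported b f -> b <= `|x| -> dsum b c f x = 0.
Proof.
move=> fb bx; rewrite /dsum /dpart big1// => j _; rewrite fb ?mulr0//.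
rewrite normrZ ger0_norm ?exprn_ge0// (le_trans bx)//.
by rewrite ler_peMl// exprn_ege1// ler1n.
Qed.

(** A neighbourhood of [x] that stays away from 0 admits a common truncation index,
    so that locally the infinite sum is a fixed finite one. *)
Lemma dsum_local b x : 0 < b -> x != 0 -> exists N, forall c f y,
  supported b f -> `|x - y| <= `|x| / 2 -> dsum b c f y = dpart c f N y.
Proof.
move=> b0 x0; have nx : 0 < `|x| by rewrite normr_gt0.
exists (Num.bound (b / (`|x| / 2))) => c f y fb xy; apply: dsumE => //.
have y2 : `|x| / 2 <= `|y|.
  have := ler_normD (x - y) y; rewrite subrK; lra.
apply: le_trans (ler_wpM2l _ y2); last by rewrite exprn_ge0.
rewrite -ler_pdivrMr ?divr_gt0// ltW//.
rewrite (lt_le_trans (archi_boundP _))// ?divr_ge0 ?(ltW b0)//.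
by rewrite -natrX ler_nat ltnW// ltn_expl.
Qed.

Lemma dsum_near b x : 0 < b -> x != 0 -> exists N, forall c f,
  supported b f -> \forall y \near x, dsum b c f y = dpart c f N y.
Proof.
move=> b0 x0; have [N dN] := dsum_local b0 x0; exists N => c f fb.
near=> y; apply: dN => //; near: y.
apply: (@cvgr_dist_le _ _ _ (nbhs x) _ idfun x) => //.
by rewrite divr_gt0// normr_gt0.
Unshelve. all: by end_near. Qed.

Lemma qdiff_at_near f g a x : (\forall y \near x, f y = g y) ->
  qdiff_at g a x -> qdiff_at f a x.
Proof.
move=> fg [C gC]; exists C; near=> v.
have -> : f (x + v) = g (x + v).
  near: v; move: (fg); rewrite (near_shift 0 x) subr0; apply: filterS => v /=.
  by rewrite addrC.
by rewrite (nbhs_singleton fg); near: v.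
Unshelve. all: by end_near. Qed.

Lemma qdiff_at_dsum b c f F x : 0 < b -> qdiff f F -> supported b f ->
  (forall k, supported b (F k)) -> x != 0 ->
  qdiff_at (dsum b c f) (fun k => dsum b (2 * c) (F k) x) x.
Proof.
move=> b0 fF fb Fb x0; have [N dN] := dsum_near b0 x0.
have -> : (fun k => dsum b (2 * c) (F k) x) = (fun k => dpart (2 * c) (F k) N x).
  by apply/funext => k; exact: nbhs_singleton (dN _ _ (Fb k)).
exact: qdiff_at_near (dN _ _ fb) (qdiffW x (qdiff_dpart c N fF)).
Qed.

Lemma dsum_continuous b c f K x : 0 < b -> lip K f -> supported b f ->
  x != 0 -> {for x, continuous (dsum b c f)}.
Proof.
move=> b0 fK fb x0; have [N dN] := dsum_near b0 x0.
have [K' dK] := lip_dpart c N fK.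
rewrite /prop_for /continuous_at (nbhs_singleton (dN c f fb)).
have := @lip_continuous _ _ _ _ dK x; apply: cvg_trans.
apply: (@near_eq_cvg _ _ (nbhs x) (nbhs_filter x)).
by apply: filterS (dN c f fb) => y ->.
Qed.

(** The powers of 2 that stay below a bound sum to at most twice that bound; the
    induction carries the companion bound [2 ^+ N * t]. *)
Lemma geometric_le N t b : 0 <= t -> 0 <= b ->
  \sum_(j < N | 2 ^+ j * t <= b) 2 ^+ j * t <= 2 * b.
Proof.
move=> t0 b0; suff : \sum_(j < N | 2 ^+ j * t <= b) 2 ^+ j * t
    <= Num.min (2 ^+ N * t) (2 * b) by rewrite le_min => /andP[].
elim: N => [|N IH]; first by rewrite big_ord0 le_min !mulr_ge0.
have p0 : 0 <= 2 ^+ N * t by rewrite mulr_ge0// exprn_ge0.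
move: IH; rewrite big_mkcond [X in _ -> X <= _]big_mkcond big_ord_recr /=.
rewrite !le_min exprS -mulrA.
move: p0; set s := \sum_(j < N) _; set q := 2 ^+ N * t => p0 /andP[s1 s2].
case: ifP => [qb|_]; apply/andP; split; lra.
Qed.

(** Since [f 0 = 0], the term of index [j] is at most [K * (2 ^+ j * `|x|)], and it
    vanishes once [2 ^+ j * `|x|] exceeds [b]. *)
Lemma dsum_le b c f K x : 0 <= K -> 0 < b -> lip K f -> supported b f ->
  f 0 = 0 -> `|c| <= 1 -> `|dsum b c f x| <= K * (2 * b).
Proof.
move=> K0 b0 fK fb f0 c1; rewrite (le_trans (ler_norm_sum _ _ _))//.
have := geometric_le (Num.bound (b / `|x|)) (normr_ge0 x) (ltW b0).
move=> /(ler_wpM2l K0); apply: le_trans; rewrite mulr_sumr [leRHS]big_mkcond /=.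
apply: ler_sum => j _; rewrite normrM normrX.
apply: (@le_trans _ _ `|f (2 ^+ j *: x)|).
  by rewrite ler_piMl// exprn_ile1.
have nE : `|2 ^+ j *: x| = 2 ^+ j * `|x| by rewrite normrZ ger0_norm// exprn_ge0.
case: ifPn => [_|]; last by rewrite -ltNge => /ltW jb; rewrite fb ?normr0// nE.
by have := fK (2 ^+ j *: x) 0; rewrite f0 !subr0 nE.
Qed.

Lemma dsum2_le b f K x : 0 <= K -> 0 < b -> lip K f -> supported b f ->
  f 0 = 0 -> x != 0 -> `|dsum b 2 f x| <= K * b * (2 * b) / `|x|.
Proof.
move=> K0 b0 fK fb f0 x0; have nx : 0 < `|x| by rewrite normr_gt0.
rewrite ler_pdivlMr// (le_trans (ler_wpM2r _ (ler_norm_sum _ _ _)))//.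
have Kb0 : 0 <= K * b by rewrite mulr_ge0// ltW.
have := geometric_le (Num.bound (b / `|x|)) (normr_ge0 x) (ltW b0).
move=> /(ler_wpM2l Kb0); apply: le_trans.
rewrite mulr_suml mulr_sumr [leRHS]big_mkcond /=.
apply: ler_sum => j _; rewrite normrM normrX ger0_norm// mulrAC mulrC.
have nE : `|2 ^+ j *: x| = 2 ^+ j * `|x| by rewrite normrZ ger0_norm// exprn_ge0.
case: ifPn => [jb|]; last first.
  by rewrite -ltNge => /ltW jb; rewrite fb ?normr0 ?mul0r// nE.
rewrite ler_wpM2r ?mulr_ge0 ?exprn_ge0//.
have := fK (2 ^+ j *: x) 0; rewrite f0 !subr0 nE => /le_trans; apply.
by rewrite ler_wpM2l.
Qed.

Lemma lform_dsum b c F x v : lform (fun k => dsum b c (F k) x) v =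
  dsum b c (fun z => lform (F ^~ z) v) x.
Proof. exact: lform_dpart. Qed.

(** The truncation index can be enlarged past [j] without changing the sum, and the
    terms other than the one of index [j] are nonnegative. *)
Lemma dsum_ge b f x j : 0 < b -> supported b f -> x != 0 ->
  (forall i : nat, 0 <= f (2 ^+ i *: x)) -> f (2 ^+ j *: x) <= dsum b 1 f x.
Proof.
move=> b0 fb x0 f0; have nx : 0 < `|x| by rewrite normr_gt0.
pose M := maxn (Num.bound (b / `|x|)) j.+1.
have bM : b <= 2 ^+ M * `|x|.
  rewrite -ler_pdivrMr// ltW// (lt_le_trans (archi_boundP _)) ?divr_ge0 ?(ltW b0)//.
  rewrite -natrX ler_nat (leq_trans (leq_maxl _ j.+1))//.
  by rewrite ltnW// ltn_expl.
have jM : (j < M)%N by rewrite leq_maxr.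
rewrite (dsumE _ fb b0 bM) /dpart (bigD1 (Ordinal jM))//= expr1n mul1r lerDl.
by apply: sumr_ge0 => i _; rewrite expr1n mul1r.
Qed.

End DyadicSum.

(** * Nearest points and slab invariance *)

Section Convexity.
Context {R : realType} {J : nat}.
Local Notation V := 'rV[R]_J.
Implicit Types (B : set V) (w x y z p : V).

Lemma convex_set_line B x y (t : R) : convex_set B -> B x -> B y ->
  0 <= t <= 1 -> B (x + t *: (y - x)).
Proof.
move=> cB Bx By /andP[t0 t1].
have := cB y x (Itv01 t0 t1); rewrite !inE => /(_ By Bx).
by rewrite /conv /= /convex_lmodType; congr B; rewrite /= scalerBl scale1r scalerBr addrCA.
Qed.

Lemma nearest_point B w : compact B -> convex_set B -> B !=set0 ->
  exists p, [/\ B p, forall x, B x -> enorm (w - p) <= enorm (w - x) &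
    forall x, B x -> 0 <= dot (p - w) (x - p)].
Proof.
move=> cptB cvxB B0.
have [|p Bp pmin] := @EVT_min_rV R J (fun x => dot (w - x) (w - x)) B B0 cptB.
  by apply: continuous_subspaceT; exact: sqr_dist_continuous.
rewrite inE in Bp; exists p; split => // [x Bx|x Bx].
  by apply: ler_wsqrtr; apply: pmin; rewrite inE.
rewrite leNgt; apply/negP => lt0.
pose a := dot (w - p) (x - p); pose q := dot (x - p) (x - p).
have a0 : 0 < a by rewrite /a -opprB dotNl oppr_gt0.
have q0 : 0 <= q := dot_ge0 _.
pose t := Num.min 1 (a / (q + 1)).
have q1 : 0 < q + 1 by rewrite ltr_wpDl.
have t0 : 0 < t by rewrite lt_min ltr01 divr_gt0.
have t1 : t <= 1 by rewrite ge_min lexx.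
have tq : t * (q + 1) <= a by rewrite -ler_pdivlMr// ge_min lexx orbT.
have := pmin (p + t *: (x - p)); rewrite inE.
have -> : w - (p + t *: (x - p)) = (w - p) - t *: (x - p) by rewrite opprD addrA.
move=> /(_ (convex_set_line cvxB Bp Bx _)); rewrite (ltW t0) t1 => /(_ isT).
have -> : dot (w - p - t *: (x - p)) (w - p - t *: (x - p)) =
    dot (w - p) (w - p) - t * (a + a - t * q).
  rewrite /a /q; move: (w - p) (x - p) => u v.
  by rewrite dotDl !dotDr !dotNl !dotNr !dotZl !dotZr (dotC v u); ring.
rewrite lerBrDr gerDl pmulr_rle0//; move: tq; rewrite mulrDr mulr1; lra.
Qed.

(** An interior point could be moved towards [w], which the variational inequality
    forbids. *)
Lemma nearest_boundary B w p : B p -> p != w ->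
  (forall x, B x -> 0 <= dot (p - w) (x - p)) -> boundary B p.
Proof.
move=> Bp pw pB; split; first exact: subset_closure.
move=> /nbhs_ballP[e /= e0 eB].
have npw : 0 < `|p - w| by rewrite normr_gt0 subr_eq0.
pose t := e / 2 / `|p - w|.
have t0 : 0 < t by rewrite !divr_gt0.
have /pB : B (p - t *: (p - w)).
  apply: eB; rewrite -ball_normE /= opprD addrA subrr sub0r !normrN normrZ.
  rewrite gtr0_norm// divfK ?gt_eqF//; lra.
rewrite addrAC subrr add0r dotNr dotZr oppr_ge0 pmulr_rle0// leNgt.
rewrite lt_neqAle dot_ge0 andbT eq_sym => /negPn/eqP d0.
by move: pw; rewrite -subr_eq0 => /eqP[]; apply: enorm_eq0; rewrite /enorm d0 sqrtr0.
Qed.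

(** If [z + t *: d] were outside [B], the direction from it to its nearest point in
    [B] would be normal to [B] at a boundary point still close to [z], hence
    orthogonal to [d]; but then [z] would lie strictly on the wrong side of the
    supporting hyperplane. *)
Lemma slab_invariance B (n d : V) (delta : R) : compact B -> convex_set B ->
  (forall z, boundary B z -> `|dot z n| < delta ->
    forall nu, unit_inward_normal B z nu -> dot nu d = 0) ->
  forall z t, B z -> `|dot z n| + J%:R * (`|t| * enorm d + `|t| * enorm d) * `|n| < delta ->
  B (z + t *: d).
Proof.
move=> cptB cvxB Bnd z t Bz zdelta; set w := z + t *: d.
have [p [Bp pmin pvi]] := nearest_point w cptB cvxB (ex_intro _ z Bz).
have [<-//|pw] := eqVneq p w.
have wz : w - z = t *: d by rewrite /w addrAC subrr add0r.
have pz : `|p - z| <= `|t| * enorm d + `|t| * enorm d.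
  have -> : p - z = (w - z) - (w - p) by rewrite opprB [RHS]addrC subrKA.
  have nz := norm_le_enorm (w - z); have np := norm_le_enorm (w - p).
  have := pmin z Bz; have := ler_normB (w - z) (w - p).
  by move: nz; rewrite {1}wz wz enormZ; lra.
have pn : `|dot p n| < delta.
  apply: le_lt_trans zdelta; rewrite -[p](subrK z) addrC dotDl.
  rewrite (le_trans (ler_normD _ _))// lerD2l (le_trans (dot_le _ _))//.
  by rewrite ler_wpM2r// ler_wpM2l.
have e0 : 0 < enorm (p - w).
  rewrite lt_neqAle sqrtr_ge0 andbT eq_sym; apply/eqP => /enorm_eq0/eqP.
  by rewrite subr_eq0 (negPf pw).
have nu : unit_inward_normal B p ((enorm (p - w))^-1 *: (p - w)).
  split; first by rewrite /unit_sphere /= enormZ ger0_norm ?invr_ge0 ?ltW// mulVf ?gt_eqF.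
  by move=> x Bx; rewrite dotZl mulr_ge0 ?invr_ge0 ?(ltW e0)// pvi.
have /eqP := Bnd p (nearest_boundary Bp pw pvi) pn _ nu.
rewrite dotZl mulf_eq0 invr_eq0 gt_eqF//= => /eqP pd.
have := pvi z Bz; have -> : z - p = - (p - w) - t *: d.
  by rewrite -wz !opprB [RHS]addrC addrA subrK.
rewrite dotDr !dotNr dotZr pd mulr0 subr0 oppr_ge0 -enorm_sqr.
by rewrite leNgt exprn_gt0.
Qed.

End Convexity.

(** * A theorem of the alternative *)

Section Alternative.
Context {R : realType} {J I : nat}.
Local Notation V := 'rV[R]_J.
Implicit Types (d : 'I_I -> V) (S : pred 'I_I).

(** The convex hull of the [d i], [i] in [S], is compact; either it contains the origin, or its
    point nearest to the origin, suitably scaled, is the required [q]. *)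
Lemma gordan_alternative d S :
  (exists q, forall i, S i -> 1 <= dot (d i) q) \/
  (exists a : 'I_I -> R, [/\ forall i, 0 <= a i,
     exists2 i, S i & 0 < a i & \sum_(i | S i) a i *: d i = 0]).
Proof.
have [[i0 Si0]|S0] := pselect (exists i, S i); last first.
  by left; exists 0 => i Si; case: S0; exists i.
pose phi (a : 'rV[R]_I) : V := \sum_i a 0 i *: d i.
pose D := [set a : 'rV[R]_I | forall i, (if S i then `[0, 1]%classic else [set 0]) (a ord0 i)]
  `&` [set a | \sum_i a 0 i = 1].
have cphi : continuous phi.
  apply: continuous_big => [|i _ a]; first exact: add_continuous.
  apply: cvgZr_tmp; [exact: nbhs_filter|exact: coord_continuous].
have cptD : compact D.
  apply: compact_closedI.
    apply: (@rV_compact _ _ (fun i => if S i then `[0, 1]%classic else [set (0 : R)])).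
    by move=> i; case: ifP => _; [exact: segment_compact|exact: compact_set1].
  apply: (@closed_comp _ _ (fun a : 'rV[R]_I => \sum_i a 0 i) [set 1]).
    move=> a _; apply: continuous_big => [|i _ b]; first exact: add_continuous.
    exact: coord_continuous.
  exact: closed_eq.
have cptK : compact (phi @` D).
  by apply: continuous_compact cptD; exact: continuous_subspaceT.
have cvxK : convex_set (phi @` D).
  move=> x y l; rewrite !inE => -[a [aS a1] <-] [b [bS b1] <-].
  pose t : R := l%:num.
  have t0 : 0 <= t by rewrite /t.
  have t1 : 0 <= 1 - t.
    rewrite subr_ge0 /t. exact: le1.

  exists (t *: a + (1 - t) *: b); last first.
    rewrite /phi /conv /= !scaler_sumr -big_split; apply: eq_bigr => i _ /=.
    by rewrite !mxE scalerDl !scalerA.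
  split => [i|/=].
    move: (aS i) (bS i); rewrite !mxE; case: ifP => _ /=.
      rewrite !in_itv /= => /andP[a0 a1'] /andP[b0 b1'].
      rewrite addr_ge0 ?mulr_ge0//=.
      have : t * a 0 i <= t by rewrite ler_piMr.
      have : (1 - t) * b 0 i <= 1 - t by rewrite ler_piMr.
      lra.
    by move=> -> ->; rewrite !mulr0 addr0.
  under eq_bigr do rewrite !mxE.
  by rewrite big_split -!mulr_sumr a1 b1 /= !mulr1 subrKC.
have K0 : (phi @` D) !=set0.
  exists (phi (delta_mx 0 i0)); exists (delta_mx 0 i0) => //; split => [i|/=].
    rewrite mxE /=; case: eqVneq => [->|_]; first by rewrite Si0 /= in_itv /= ler01 lexx.
    by case: ifP => _ //=; rewrite in_itv /= lexx ler01.
  rewrite (bigD1 i0)//= mxE !eqxx big1 ?addr0// => i ii0.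
  by rewrite mxE (negPf ii0) andbF.
have [p [[a [aS a1] <-] _ pvi]] := nearest_point 0 cptK cvxK K0.
have a0 i : 0 <= a 0 i.
  by move: (aS i); case: ifP => _ /=; [rewrite in_itv /= => /andP[]|move=> ->].
have phiE : phi a = \sum_(i | S i) a 0 i *: d i.
  rewrite /phi [RHS]big_mkcond; apply: eq_bigr => i _.
  by move: (aS i); case: ifP => // _ /= ->; rewrite scale0r.
have [p0|pn0] := eqVneq (phi a) 0.
  right; exists (fun i => a 0 i); split => //; last by rewrite -phiE.
  have [i /andP[Si ai]|none] := pickP [pred i | S i && (0 < a 0 i)]; first by exists i.
  have /eqP := a1; rewrite big1 ?(eq_sym 0) ?oner_eq0// => i _.
  move: (aS i) (none i) (a0 i); rewrite /= le_eqVlt; case: (S i) => //= _ -> .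
  by rewrite orbF => /eqP.
left; have e0 : 0 < dot (phi a) (phi a).
  rewrite lt_neqAle dot_ge0 andbT eq_sym; apply: contra_neq pn0 => e0.
  by apply: enorm_eq0; rewrite /enorm e0 sqrtr0.
exists ((dot (phi a) (phi a))^-1 *: phi a) => i Si.
rewrite dotZr ler_pdivlMl// mulr1 dotC -subr_ge0 -dotNr -dotDr.
have := pvi (d i); rewrite subr0; apply; exists (delta_mx 0 i).
  split => [j|/=].
    rewrite mxE /=; case: eqVneq => [->|_]; first by rewrite Si /= in_itv /= ler01 lexx.
    by case: ifP => _ //=; rewrite in_itv /= lexx ler01.
  rewrite (bigD1 i)//= mxE !eqxx big1 ?addr0// => j ji.
  by rewrite mxE (negPf ji) andbF.
rewrite /phi (bigD1 i)//= mxE !eqxx scale1r big1 ?addr0// => j ji.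
by rewrite mxE (negPf ji) andbF scale0r.
Qed.

(** If a nontrivial nonnegative combination of the active directions vanished, then
    [d j] and [- d j], for [j] with a positive coefficient, would both be reflection
    directions at [x], after normalization, and [x] would belong to V. *)
Lemma pointed_cone_functional (n : 'I_I -> V) d x :
  (forall i, dot (d i) (n i) = 1) ->
  boundary (polyhedron n (fun=> 0)) x -> ~ V_set d n (fun=> 0) x ->
  exists q, forall i, dot x (n i) = 0 -> 1 <= dot (d i) q.
Proof.
move=> dn Gx nVx.
have [[q qd]|[a [a0 [j Sj aj] a_eq0]]] :=
    gordan_alternative d (active n (fun=> 0) x).
  by exists q => i xi; apply: qd; apply/eqP.
have e0 : 0 < enorm (d j).
  rewrite lt_neqAle sqrtr_ge0 andbT eq_sym; apply/eqP => /enorm_eq0 dj.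
  by have := dn j; rewrite dj dot0l => /eqP; rewrite eq_sym oner_eq0.
have s0 : 0 < (enorm (d j))^-1 by rewrite invr_gt0.
pose u := (enorm (d j))^-1 *: d j.
have u1 : enorm u = 1.
  by rewrite enormZ ger0_norm ?ltW// mulVf ?gt_eqF.
case: nVx; split => //; exists u => //; split; split => //.
- right; split => //; exists (fun i => if i == j then (enorm (d j))^-1 else 0).
    by move=> i; case: ifP => _ //; exact: ltW.
  rewrite (bigD1 j)//= eqxx big1 ?addr0// => i /andP[_ /negPf ->].
  by rewrite scale0r.
- right; split => //.
  exists (fun i => if i == j then 0 else (enorm (d j))^-1 * (a i / a j)).
    by move=> i; case: ifP => _ //; rewrite !mulr_ge0 ?invr_ge0// ltW.
  have := congr1 (fun z => ((enorm (d j))^-1 * (a j)^-1) *: z) a_eq0.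
  rewrite scaler0 (bigD1 j)//= scalerDr scalerA -mulrA mulVf ?gt_eqF// mulr1.
  move/eqP; rewrite addr_eq0 => /eqP uE; rewrite /u uE opprK.
  rewrite [RHS](bigD1 j)//= eqxx scale0r add0r scaler_sumr.
  apply: eq_bigr => i /andP[_ /negPf ->].
  by rewrite scalerA -mulrA [(a j)^-1 * _]mulrC.
- by rewrite /unit_sphere /= -scaleN1r enormZ normrN1 mul1r.
Qed.

End Alternative.

(** * A bump function adapted to the reflection directions *)

Section LocalBump.
Context {R : realType} {J I : nat}.
Local Notation V := 'rV[R]_J.
Implicit Types (B : set V) (x y z q : V) (n d : 'I_I -> V).

Lemma compact_distance B : compact B -> B !=set0 ->
  exists D : V -> R, (forall y b, B b -> D y <= `|y - b|) /\
    forall y, exists2 b, B b & D y = `|y - b|.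
Proof.
move=> cptB B0.
have near_pt y : exists b, B b /\ forall b', B b' -> `|y - b| <= `|y - b'|.
  have [|b Bb bmin] := @EVT_min_rV R J (fun b => `|y - b|) B B0 cptB.
    apply: continuous_subspaceT; apply: (@lip_continuous _ _ 1) => u v.
    rewrite mul1r (le_trans (ler_dist_dist _ _))// opprD addrACA subrr add0r.
    by rewrite opprK addrC distrC.
  rewrite inE in Bb; exists b; split => // b' Bb'.
  by apply: bmin; rewrite inE.
have [p pP] := choice near_pt; exists (fun y => `|y - p y|); split => [y b Bb|y].
  by have [_] := pP y; apply.
by exists (p y) => //; have [] := pP y.
Qed.

Definition bump (eps kap : R) q (D : V -> R) z :=
  Num.max 0 (eps - D z + kap * dot z q).

Lemma lip_max0 K (f : V -> R) : lip K f -> lip K (fun z => Num.max 0 (f z)).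
Proof.
move=> fK x y; apply: le_trans (fK x y).
have [x0|x0] := leP 0 (f x); have [y0|y0] := leP 0 (f y) => //.
- by rewrite subr0 !ger0_norm ?subr_ge0//; lra.
- by rewrite sub0r normrN (distrC (f x)) !ger0_norm ?subr_ge0//; lra.
- by rewrite subrr normr0.
Qed.

(** If the bump is positive at [z], then [z] is close to a point [b] of [B]; in the
    slab, [b + t *: d i] is in [B] too, so the distance to [B] does not increase from
    [z] to [z + t *: d i], while the linear term grows by at least [t * kap]. The
    slope [kap] is taken so small that the linear term neither spoils the bounded
    support nor exceeds [eps] on it. *)
Lemma bump_origin B n d (delta : R) q (P : 'I_I -> Prop) :
  compact B -> convex_set B -> B 0 -> 0 < delta ->
  (forall i, `|n i| <= 1) -> (forall i, P i -> 1 <= dot (d i) q) ->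
  (forall i z, boundary B z -> `|dot z (n i)| < delta ->
    forall nu, unit_inward_normal B z nu -> dot nu (d i) = 0) ->
  exists (psi : V -> R) (K rho eta tau kap : R),
  [/\ lip K psi, forall z, 0 <= psi z,
      [/\ 0 < rho, 0 < eta, 0 < tau & 0 < kap],
      forall z, rho <= `|z| -> psi z = 0 &
      forall i z t, P i -> `|dot z (n i)| <= eta -> 0 <= t <= tau ->
        psi z <= psi (z + t *: d i) /\
        (`|z| <= eta -> psi z + t * kap <= psi (z + t *: d i))].
Proof.
move=> cptB cvxB B0 delta0 n1 dq Bnd.
have [D [Dle Dex]] := compact_distance cptB (ex_intro _ 0 B0).
have [r r0 Br] : exists2 r, 0 <= r & forall b, B b -> `|b| <= r.
  have [M [_ /(_ (`|M| + 1))]] := compact_bounded cptB.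
  rewrite (le_lt_trans (ler_norm M)) ?ltrDl// => /(_ isT) BM.
  by exists (`|M| + 1); [rewrite addr_ge0|exact: BM].
have Dlip : lip 1 D.
  have le1 y y' : D y <= D y' + `|y - y'|.
    have [b Bb ->] := Dex y'; rewrite (le_trans (Dle y b Bb))//.
    have -> : y - b = (y - y') + (y' - b) by rewrite addrA subrK.
    by rewrite addrC ler_normD.
  by move=> y y'; rewrite mul1r ler_distl lerBlDr distrC le1 distrC le1.
(* [J.+1] rather than [J] keeps the constants positive in dimension 0. *)
pose N : R := J.+1%:R; have N1 : 1 <= N by rewrite ler1n.
have N0 : 0 < N by lra.
have JN : J%:R <= N by rewrite ler_nat leqnSn.
have dotN (u v : V) : `|dot u v| <= N * `|u| * `|v|.
  by rewrite (le_trans (dot_le _ _))// !ler_wpM2r.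
pose eps := delta / (8 * N).
have Neps : N * eps = delta / 8 by rewrite /eps; field; rewrite gt_eqF.
have eps0 : 0 < eps by rewrite divr_gt0// mulr_gt0.
have epsN : eps <= N * eps by rewrite ler_peMl// ltW.
pose rho := 2 * (r + eps); have rho0 : 0 < rho by rewrite /rho; lra.
pose Q := N * `|q| + 1; have Q0 : 0 < Q by rewrite ltr_wpDl// mulr_ge0// ltW.
pose kap := eps / (rho * Q).
have kap0 : 0 < kap by rewrite divr_gt0// mulr_gt0.
have kapq z : kap * dot z q <= eps / rho * `|z|.
  have -> : eps / rho = kap * Q by rewrite /kap; field; rewrite !gt_eqF.
  rewrite -mulrA ler_wpM2l ?(ltW kap0)// (le_trans (ler_norm _))//.
  rewrite (le_trans (dotN _ _))// mulrAC /Q mulrDl mul1r -[leLHS]addr0 lerD//.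
have epsrho : eps / rho <= 1 / 2 by rewrite ler_pdivrMr// /rho; lra.
(* Chosen so that the displacements [t *: d i] use up at most a quarter of
   the width [delta] in [slab_invariance]. *)
pose tau := delta / (8 * (N * (1 + \sum_i enorm (d i)))).
have S0 : 0 <= \sum_i enorm (d i) by apply: sumr_ge0 => i _; exact: sqrtr_ge0.
have T0 : 0 < N * (1 + \sum_i enorm (d i)) by rewrite mulr_gt0//; lra.
have tau0 : 0 < tau by rewrite divr_gt0// mulr_gt0.
have NtauE : N * tau * (1 + \sum_i enorm (d i)) = delta / 8.
  rewrite /tau; field; rewrite !gt_eqF//; lra.
pose psi := bump eps kap q D.
have psi0 z : 0 <= psi z by rewrite /psi /bump le_max lexx.
have psi_pos z : 0 < psi z -> [/\ psi z = eps - D z + kap * dot z q,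
    `|z| < rho & D z < eps + eps].
  rewrite /psi /bump; set w := eps - D z + _.
  have [w0|w0 _] := leP w 0; first by rewrite ltxx.
  have [b Bb DE] := Dex z; have kz := kapq z.
  have z2 : eps / rho * `|z| <= 1 / 2 * `|z| by rewrite ler_wpM2r.
  have zb : `|z| <= `|b| + D z by rewrite DE addrC -{1}(subrK b z) ler_normD.
  have bb := Br b Bb.
  have zrho : `|z| < rho by move: w0; rewrite /w /rho; lra.
  have : eps / rho * `|z| <= eps.
    by rewrite mulrAC -mulrA ler_piMr ?(ltW eps0)// ler_pdivrMr// mul1r ltW.
  by split => //; move: w0; rewrite /w; lra.
have psi_lip : lip (1 + `|kap| * (N * `|q|)) psi.
  apply: lip_max0; apply: lip_add => [y y'|].
    by rewrite opprD addrACA subrr add0r opprK addrC distrC.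
  apply: lip_scale => y y'; rewrite -dotNl -dotDl.
  by rewrite (le_trans (dotN _ _))// mulrAC.
exists psi, (1 + `|kap| * (N * `|q|)), rho, (eps / 2), tau, kap; split => //.
- by rewrite divr_gt0.
- move=> z rz; apply/eqP; rewrite eq_le psi0 andbT leNgt; apply/negP.
  by move=> /psi_pos[_ zr _]; move: zr; rewrite ltNge rz.
move=> i z t Pi zn /andP[t0 ttau].
have grow : 0 < psi z -> psi z + t * kap <= psi (z + t *: d i).
  move=> /psi_pos[-> zrho Dz]; have [b Bb DE] := Dex z.
  have Bt : B (b + t *: d i).
    apply: (slab_invariance cptB cvxB (Bnd i)) => //.
    have bz : `|b - z| <= eps + eps by rewrite distrC -DE ltW.
    have bn : `|dot b (n i)| <= eps / 2 + N * (eps + eps).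
      rewrite -[b](subrK z) addrC dotDl (le_trans (ler_normD _ _))// lerD//.
      rewrite (le_trans (dotN _ _))// -[leRHS]mulr1 ler_pM// ?mulr_ge0// ?(ltW N0)//.
      by rewrite ler_wpM2l// ltW.
    have tde : `|t| * enorm (d i) <= tau * (1 + \sum_i enorm (d i)).
      rewrite ger0_norm// ler_pM ?sqrtr_ge0// (bigD1 i)//= addrCA lerDl addr_ge0//.
      by apply: sumr_ge0 => j _; exact: sqrtr_ge0.
    have e0 := sqrtr_ge0 (dot (d i) (d i)); rewrite -/(enorm (d i)) in e0.
    have te0 : 0 <= `|t| * enorm (d i) by rewrite mulr_ge0.
    have Nt : J%:R * (`|t| * enorm (d i) + `|t| * enorm (d i)) * `|n i| <=
        delta / 8 + delta / 8.
      rewrite -[leRHS]mulr1 ler_pM// ?mulr_ge0// ?addr_ge0//.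
      rewrite -NtauE; set S := 1 + _.
      have -> : N * tau * S + N * tau * S = N * (tau * S + tau * S) by ring.
      by rewrite ler_pM// ?addr_ge0//; exact: lerD.
    by apply: (le_lt_trans (lerD bn Nt)); rewrite mulrDr Neps; move: Neps epsN; lra.
  rewrite /psi /bump le_max; apply/orP; right.
  have Dt : D (z + t *: d i) <= D z.
    rewrite DE (le_trans (Dle _ _ Bt))// opprD addrACA subrr addr0.
    exact: lexx.
  have : t * kap <= kap * dot (t *: d i) q.
    by rewrite dotZl [leRHS]mulrCA ler_wpM2l// ler_peMr ?(ltW kap0)// dq.
  by rewrite dotDl mulrDr; lra.
split.
  have := psi0 z; rewrite le_eqVlt => /orP[/eqP <- //|/[dup] /grow].
  by move=> h _; apply: le_trans h; rewrite lerDl mulr_ge0// ltW.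
move=> ze; apply: grow; rewrite /psi /bump lt_max; apply/orP; right.
have D1 := Dle z 0 B0; rewrite subr0 in D1.
have := kapq (- z); rewrite dotNl mulrN normrN.
have : eps / rho * `|z| <= 1 / 2 * `|z| by rewrite ler_wpM2r.
lra.
Qed.

End LocalBump.

(** * Localization and gluing *)

Section Gluing.
Context {R : realType} {J I : nat}.
Local Notation V := 'rV[R]_J.
Implicit Types (B W A : set V) (x y z q : V) (n d : 'I_I -> V).

(** In a small ball around [x] the hyperplanes with [dot x (n i) != 0] are avoided,
    and the others pass through [x], so that they are invariant under dilations
    centred at [x]: a scaled copy of the bump at the origin works. *)
Lemma bump_at B n d (delta : R) q x (rad : R) :
  compact B -> convex_set B -> B 0 -> 0 < delta ->
  (forall i, `|n i| <= 1) -> (forall i, dot x (n i) = 0 -> 1 <= dot (d i) q) ->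
  (forall i z, boundary B z -> `|dot z (n i)| < delta ->
    forall nu, unit_inward_normal B z nu -> dot nu (d i) = 0) ->
  0 < rad ->
  exists (psi : V -> R) (K eta tau theta : R),
  [/\ lip K psi, forall z, 0 <= psi z,
      [/\ 0 < eta, 0 < tau & 0 < theta],
      forall z, rad <= `|z - x| -> psi z = 0 &
      forall i z t, `|dot z (n i)| <= eta -> 0 <= t <= tau ->
        psi z <= psi (z + t *: d i) /\
        (`|z - x| <= eta -> psi z + t * theta <= psi (z + t *: d i))].
Proof.
move=> cptB cvxB B0 delta0 n1 dq Bnd rad0.
have [psi [K [rho [eta [tau [kap [psiK psi0 [rho0 eta0 tau0 kap0] psirho grow]]]]]]] :=
  bump_origin cptB cvxB B0 delta0 n1 dq Bnd.
have [m m0 mx] : exists2 m : R, 0 < m & forall i, dot x (n i) != 0 -> m <= `|dot x (n i)|.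
  exists (\big[Num.min/1]_(i | dot x (n i) != 0) `|dot x (n i)|).
    by apply: lt_bigmin => // i; rewrite normr_gt0.
  by move=> i xi; apply: bigmin_le_cond.
pose N : R := J.+1%:R; have N1 : 1 <= N by rewrite ler1n.
have N0 : 0 < N by lra.
pose r := Num.min rad (m / (4 * N)).
have r0 : 0 < r by rewrite lt_min rad0 divr_gt0// mulr_gt0.
have rrad : r <= rad by rewrite ge_min lexx.
have rm : N * r <= m / 4.
  have -> : m / 4 = N * (m / (4 * N)) by field; rewrite gt_eqF.
  by rewrite ler_wpM2l ?(ltW N0)// ge_min lexx orbT.
pose s := r / rho; have s0 : 0 < s by rewrite divr_gt0.
pose eta1 := Num.min (s * eta) (Num.min (m / 4) (r / 2)).
have [e1 e2 e3] : [/\ eta1 <= s * eta, eta1 <= m / 4 & eta1 <= r / 2].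
  by rewrite /eta1 !ge_min !lexx !orbT.
pose phi z := psi (s^-1 *: (z - x)).
have supp_phi z : r <= `|z - x| -> phi z = 0.
  move=> rz; apply: psirho; rewrite normrZ gtr0_norm ?invr_gt0//.
  by rewrite ler_pdivlMl// /s divfK ?gt_eqF.
exists phi, (K * s^-1), eta1, (s * tau), (kap / s); split.
- move=> y z; rewrite (le_trans (psiK _ _))// -scalerBr normrZ.
  by rewrite gtr0_norm ?invr_gt0// opprB addrA subrK mulrA.
- by move=> z; exact: psi0.
- split; [by rewrite !lt_min !divr_gt0// mulr_gt0|exact: mulr_gt0|exact: divr_gt0].
- by move=> z rz; apply: supp_phi; exact: le_trans rz.
move=> i z t zn /andP[t0 tt].
have [xi|xi] := eqVneq (dot x (n i)) 0.
  have -> : phi (z + t *: d i) = psi (s^-1 *: (z - x) + (t / s) *: d i).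
    by rewrite /phi addrAC scalerDr scalerA mulrC.
  have [||mono strict] := grow i (s^-1 *: (z - x)) (t / s) xi.
  - rewrite dotZl dotDl dotNl xi subr0 normrM gtr0_norm ?invr_gt0//.
    by rewrite ler_pdivrMl// (le_trans zn).
  - by rewrite divr_ge0 ?(ltW s0)//= ler_pdivrMr// mulrC.
  split => // zx; have -> : t * (kap / s) = t / s * kap by ring.
  apply: strict.
  by rewrite normrZ gtr0_norm ?invr_gt0// ler_pdivrMl// (le_trans zx).
(* The slab of an index inactive at [x] does not meet the support. *)
have far : r < `|z - x|.
  rewrite ltNge; apply/negP => zxr.
  have := dot_le (z - x) (n i); rewrite dotDl dotNl => zx.
  have zx' : `|dot z (n i) - dot x (n i)| <= N * r.
    rewrite (le_trans zx)// -[leRHS]mulr1 ler_pM// ?mulr_ge0//.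
    by rewrite ler_pM// ler_nat.
  have := mx i xi; have := ler_normB (dot z (n i)) (dot z (n i) - dot x (n i)).
  rewrite opprB subrKC; lra.
split; first by rewrite supp_phi ?psi0// ltW.
by move=> zx; exfalso; lra.
Qed.

(** What is required of the test function before smoothing. The inequalities are
    finite-difference versions of the sign conditions on the derivative, and they
    are imposed on a neighbourhood of the hyperplanes, also outside the cone: in
    this form they are stable under sums, which glue the local bumps, and under
    averages over small translations, which smooth the result. *)
Definition pushed n d (lo hi : R) W := exists (psi : V -> R) (K eta tau theta : R),
  [/\ lip K psi, forall z, 0 <= psi z,
      [/\ 0 < eta, 0 < tau & 0 < theta],
      forall z, ~~ (lo < `|z| < hi) -> psi z = 0 &
      forall i z t, `|dot z (n i)| <= eta -> 0 <= t <= tau ->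
        psi z <= psi (z + t *: d i) /\
        forall y, W y -> `|z - y| <= eta -> psi z + t * theta <= psi (z + t *: d i)].

Lemma pushed_sub n d lo hi W1 W2 : W1 `<=` W2 ->
  pushed n d lo hi W2 -> pushed n d lo hi W1.
Proof.
move=> W12 [psi [K [eta [tau [theta [? ? ? ? grow]]]]]].
exists psi, K, eta, tau, theta; split => // i z t zn tt.
by have [? st] := grow i z t zn tt; split => // y /W12; exact: st.
Qed.

Lemma pushed0 n d lo hi : pushed n d lo hi set0.
Proof. by exists (fun=> 0), 0, 1, 1, 1; split => //; exact: lip_cst. Qed.

Lemma pushedU n d lo hi W1 W2 : pushed n d lo hi W1 -> pushed n d lo hi W2 ->
  pushed n d lo hi (W1 `|` W2).
Proof.
move=> [f [K [e [tau [th [fK f0 [e0 tau0 th0] fs fg]]]]]].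
move=> [f' [K' [e' [tau' [th' [fK' f0' [e0' tau0' th0'] fs' fg']]]]]].
exists (fun z => f z + f' z), (K + K'), (Num.min e e'), (Num.min tau tau'),
  (Num.min th th'); split.
- exact: lip_add.
- by move=> z; rewrite addr_ge0.
- by rewrite !lt_min; split; apply/andP.
- by move=> z zs; rewrite fs// fs'// addr0.
move=> i z t; rewrite !le_min => /andP[ze ze'] /and3P[t0 tt tt'].
have [m st] := fg i z t ze (introT andP (conj t0 tt)).
have [m' st'] := fg' i z t ze' (introT andP (conj t0 tt')).
split; first exact: lerD.
have tm : t * Num.min th th' <= t * th by rewrite ler_wpM2l// ge_min lexx.
have tm' : t * Num.min th th' <= t * th' by rewrite ler_wpM2l// ge_min lexx orbT.
by move=> y [] Wy; rewrite le_min => /andP[ye ye'];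
  [have := st y Wy ye|have := st' y Wy ye']; lra.
Qed.

Lemma pushed_compact n d lo hi A : compact A ->
  (forall x, A x -> exists2 e : R, 0 < e & pushed n d lo hi (ball x e)) ->
  pushed n d lo hi A.
Proof.
move=> cptA Aloc.
have /choice[e eP] : forall x, exists r : R,
    A x -> 0 < r /\ pushed n d lo hi (ball x r).
  by move=> x; have [/Aloc[r r0 rP]|nAx] := pselect (A x); [exists r|exists 0].
move: cptA; rewrite compact_cover => /(_ V A (fun x => ball x (e x))) [||D DA AD].
- by move=> x /eP[e0 _]; exact: ball_open.
- by move=> x Ax; exists x => //; apply: ballxx; have [] := eP x Ax.
apply: (pushed_sub AD).
have [s sE] : exists s : seq V, [set` D] = [set` s].
  by apply/finite_seqP; exact: finite_fset.
have {DA} : forall x, x \in s -> A x.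
  move=> x xs; have xD : [set` D] x by rewrite sE.
  by have := DA _ xD; rewrite inE.
rewrite {}sE /cover; elim: s => [_|x s IH sub].
  by apply: pushed_sub (pushed0 n d lo hi) => y [].
apply: (@pushed_sub _ _ _ _ _
    (ball x (e x) `|` \bigcup_(i in [set` s]) ball i (e i))).
  move=> y [z /=]; rewrite inE => /orP[/eqP -> ?|zs zy]; first by left.
  by right; exists z.
apply: pushedU; first by have [] := eP x (sub x (mem_head _ _)).
by apply: IH => z zs; apply: sub; rewrite inE zs orbT.
Qed.

End Gluing.

(** * The shell of the cone boundary *)

Section Cone.
Context {R : realType} {J I : nat}.
Local Notation V := 'rV[R]_J.
Implicit Types (n d : 'I_I -> V) (x : V).
Local Notation cone n := (polyhedron n (fun=> 0)).

Lemma cone_scale n x (c : R) : 0 < c -> cone n (c *: x) <-> cone n x.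
Proof.
by move=> c0; split => nx i; have := nx i; rewrite dotZl pmulr_rge0.
Qed.

Lemma boundary_cone_scale n x (c : R) : 0 < c ->
  boundary (cone n) x -> boundary (cone n) (c *: x).
Proof.
move=> c0 [clx nix]; have sc : (fun y : V => c *: y) @ x --> c *: x.
  exact: scaler_continuous.
split.
  by move=> W /sc /clx[y [ny Wy]]; exists (c *: y); split => //; apply/(cone_scale n y c0).
move=> intx; apply: nix; have : nbhs x [set y | cone n (c *: y)] := sc _ intx.
by apply: filterS => y /(cone_scale n y c0).
Qed.

Lemma closed_boundary (T : topologicalType) (A : set T) : closed (boundary A).
Proof.
rewrite /boundary setDE; apply: closedI; first exact: closed_closure.
by apply: open_closedC; exact: open_interior.
Qed.

Lemma cone_shell_pushed n d (delta : R) (B : set V) (alpha : R) :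
  polyhedral_ESP d n (fun=> 0) -> V_set d n (fun=> 0) = [set 0] ->
  compact B -> convex_set B -> B 0 -> 0 < delta ->
  (forall i z, boundary B z -> `|dot z (n i)| < delta ->
    forall nu, unit_inward_normal B z nu -> dot nu (d i) = 0) ->
  0 < alpha ->
  pushed n d (alpha / 2) (3 * alpha)
    (boundary (cone n) `&` [set x | alpha <= `|x| <= 2 * alpha]).
Proof.
move=> [n1 dn _] V0 cptB cvxB B0 delta0 Bnd alpha0.
have nle i : `|n i| <= 1 by rewrite -(n1 i) norm_le_enorm.
have nc : continuous (fun x : V => `|x|) by exact: norm_continuous.
apply: pushed_compact => [|x [bx /= /andP[x1 x2]]].
  apply: bounded_closed_compact.
    exists (2 * alpha); split; first exact: num_real.
    by move=> t at_ x [_ /= /andP[_ xa]]; rewrite (le_trans xa)// ltW.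
  apply: closedI; first exact: closed_boundary.
  have -> : [set x : V | alpha <= `|x| <= 2 * alpha] =
      (fun x => `|x|) @^-1` `[alpha, 2 * alpha]%classic.
    by apply/seteqP; split => x /=; rewrite in_itv.
  by apply: (@closed_comp _ _ (fun x : V => `|x|)); [move=> y _; exact: nc|exact: itv_closed].
have nVx : ~ V_set d n (fun=> 0) x.
  by rewrite V0 => x0; move: x1; rewrite x0 normr0 leNgt alpha0.
have [q qd] := pointed_cone_functional dn bx nVx.
have [psi [K [eta [tau [theta [psiK psi0 [eta0 tau0 theta0] supp grow]]]]]] :=
  bump_at cptB cvxB B0 delta0 nle qd Bnd (divr_gt0 alpha0 (ltr0n _ 2)).
exists (eta / 2); first by rewrite divr_gt0.
exists psi, K, (eta / 2), tau, theta; split => //; first by rewrite divr_gt0.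
  move=> z /negP zs; apply: supp; rewrite leNgt; apply/negP => zx; apply: zs.
  have := ler_normD (x - z) z; have := ler_normD (z - x) x.
  rewrite !subrK (distrC x z) => h1 h2; apply/andP; split; lra.
move=> i z t zn tt; have [|mono strict] := grow i z t _ tt.
  by rewrite (le_trans zn)//; lra.
split => // y; rewrite -ball_normE /= => xy zy; apply: strict.
have -> : z - x = (z - y) - (x - y) by rewrite opprB addrA subrK.
rewrite (le_trans (ler_normB _ _))//; lra.
Qed.

(** Take the least [j] that brings [x] out of the ball of radius [alpha]: the
    preceding power left it inside. *)
Lemma dyadic_shell x (alpha : R) : x != 0 -> 0 < alpha -> `|x| <= alpha ->
  exists j, alpha <= `|2 ^+ j *: x| <= 2 * alpha.
Proof.
move=> x0 a0 xa; have nx : 0 < `|x| by rewrite normr_gt0.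
have nE j : `|2 ^+ j *: x| = 2 ^+ j * `|x| by rewrite normrZ ger0_norm// exprn_ge0.
have ex : exists j, alpha <= `|2 ^+ j *: x|.
  exists (Num.bound (alpha / `|x|)).
  rewrite nE -ler_pdivrMr// ltW// (lt_le_trans (archi_boundP _))//.
    by rewrite divr_ge0// ltW.
  by rewrite -natrX ler_nat ltnW// ltn_expl.
have [[|j] aj jmin] := ex_minnP ex; [exists 0%N|exists j.+1].
  rewrite aj /= expr0 scale1r; lra.
rewrite aj /= nE exprS -mulrA ler_wpM2l// leNgt; apply/negP => ja.
by have := jmin j; rewrite nE ltW// => /(_ isT); rewrite ltnn.
Qed.

Lemma dist_set_origin x : dist_set x [set 0] = enorm x.
Proof. by rewrite /dist_set image_set1 subr0 inf1. Qed.

End Cone.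

(** * Smoothing and summation *)

Section SmoothPush.
Context {R : realType} {J I : nat}.
Local Notation V := 'rV[R]_J.
Implicit Types (n d : 'I_I -> V) (x y u : V).

(** Averages of translates of [psi] inherit its growth along [d i] on the hyperplane
    orthogonal to [n i], since [rho] is small enough for these translates to stay in
    the slab; the derivative along [d i] is then bounded below by [qdiff_ge]. *)
Lemma pushed_smooth n d (lo hi : R) (W : set V) : (forall i, `|n i| <= 1) ->
  0 < lo -> pushed n d lo hi W ->
  exists f F1 F2 theta, [/\ jet2 f F1 F2, 0 < theta,
    [/\ supported (hi + lo) f, forall k, supported (hi + lo) (F1 k) &
      forall k l, supported (hi + lo) (F2 k l)],
    [/\ f 0 = 0, forall k, F1 k 0 = 0 & forall k l, F2 k l 0 = 0] &
    forall i x, dot x (n i) = 0 -> 0 <= lform (F1 ^~ x) (d i) /\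
      (W x -> theta <= lform (F1 ^~ x) (d i))].
Proof.
move=> n1 lo0 [psi [K [eta [tau [theta [psiK psi0 [eta0 tau0 theta0] supp grow]]]]]].
pose rho := Num.min lo (eta / J.+1%:R).
have rho0 : 0 < rho by rewrite lt_min lo0 divr_gt0.
have rlo : rho <= lo by rewrite ge_min lexx.
have reta : J.+1%:R * rho <= eta by rewrite mulrC -ler_pdivlMr// ge_min lexx orbT.
have reta1 : rho <= eta by apply: le_trans reta; rewrite ler_peMl ?ler1n// ltW.
have [f [F1 [F2 [jf mono zero]]]] := smooth_approximation psiK rho0.
have out x : hi + lo <= `|x| -> [/\ f x = 0, forall k, F1 k x = 0 & forall k l, F2 k l x = 0].
  move=> hx; apply: zero => u ur; apply: supp; apply/negP => /andP[_].
  have := ler_normB (x + u) u; rewrite addrK; lra.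
have [f0 F10 F20] : [/\ f 0 = 0, forall k, F1 k 0 = 0 & forall k l, F2 k l 0 = 0].
  apply: zero => u ur; apply: supp; apply/negP => /andP[]; rewrite add0r; lra.
exists f, F1, F2, theta; split => //.
  by split=> [x /out[]//|k x /out[]//|k l x /out[]//].
move=> i x xn.
have xun u : `|u| <= rho -> `|dot (x + u) (n i)| <= eta.
  move=> ur; rewrite dotDl xn add0r (le_trans (dot_le _ _))// -[leRHS]mulr1.
  rewrite ler_pM ?mulr_ge0// (le_trans _ reta)// ler_pM// ler_nat leqnSn//.
split=> [|Wx]; apply: (qdiff_ge (jet2_diff1 jf) tau0) => t tt.
  rewrite mulr0; apply: mono => u ur; rewrite addr0 addrAC.
  by have [] := grow i (x + u) t (xun u ur) tt.
apply: mono => u ur; rewrite [x + _ + u]addrAC.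
have [_ strict] := grow i (x + u) t (xun u ur) tt; apply: (strict x Wx).
by rewrite addrAC subrr add0r (le_trans ur).
Qed.

(** Away from the origin the sum is locally finite, so it can be differentiated
    term by term, twice. *)
Lemma dsum_partials b f F1 F2 : 0 < b -> jet2 f F1 F2 -> supported b f ->
  (forall k, supported b (F1 k)) -> (forall k l, supported b (F2 k l)) ->
  let g := dsum b 2^-1 f in
  forall x : V, x != 0 ->
  [/\ differentiable g x, forall k, differentiable (partial k g) x,
      forall k, partial k g x = dsum b 1 (F1 k) x,
      forall k l, partial l (partial k g) x = dsum b 2 (F2 k l) x &
      forall k l, {for x, continuous (partial l (partial k g))}].
Proof.
move=> b0 jf fb F1b F2b g.
have half : 2 * 2^-1 = 1 :> R by rewrite mulfV.
have nz x : x != 0 -> \forall y \near x, y != 0.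
  by move=> x0; apply: (@cvgr_neq0 _ _ _ (nbhs x) _ idfun x).
have g1 x : x != 0 -> qdiff_at g (fun k => dsum b 1 (F1 k) x) x.
  by move=> x0; rewrite -half; exact: qdiff_at_dsum (jet2_diff1 jf) _ _ _.
have p1 k x : x != 0 -> partial k g x = dsum b 1 (F1 k) x.
  by move=> /g1/(qdiff_at_partial k).
have g2 k x : x != 0 -> qdiff_at (partial k g) (fun l => dsum b 2 (F2 k l) x) x.
  move=> x0; apply: (@qdiff_at_near _ _ _ (dsum b 1 (F1 k))).
    by apply: filterS (nz x x0) => y; exact: p1.
  have := qdiff_at_dsum 1 b0 (jet2_diff2 jf k) (F1b k) (F2b k) x0.
  by rewrite mulr1.
have p2 k l x : x != 0 -> partial l (partial k g) x = dsum b 2 (F2 k l) x.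
  by move=> /(g2 k)/(qdiff_at_partial l).
move=> x x0; split => //.
- by have [] := qdiff_at_differentiable (g1 x x0).
- by move=> k; have [] := qdiff_at_differentiable (g2 k x x0).
- by move=> k; exact: p1.
- by move=> k l; exact: p2.
move=> k l; have [K FK] := jet2_lip2 jf.
have := @dsum_continuous _ _ b 2 _ _ _ b0 (FK k l) (F2b k l) x0.
rewrite /prop_for /continuous_at p2//; apply: cvg_trans.
apply: (@near_eq_cvg _ _ (nbhs x) (nbhs_filter x)).
by apply: filterS (nz x x0) => y y0; rewrite p2.
Qed.

End SmoothPush.

(** * The test function *)

Theorem theorem5p9 (R : realType) (J I : nat) (d n : 'I_I -> 'rV[R]_J)
    (G := polyhedron n (fun=> 0)) (V := V_set d n (fun=> 0))
    (U := U_set d n (fun=> 0)) (d1 := unit_refl_dir d n (fun=> 0)) :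
  polyhedral_ESP d n (fun=> 0) ->
  angle_lt_pi G ->
  V = [set 0] ->
  (exists (B : set 'rV[R]_J) (delta : R),
    [/\ [/\ compact B, convex_set B, symmetric_set B & interior B 0],
        0 < delta &
        forall (i : 'I_I) (z : 'rV[R]_J),
          boundary B z -> `|dot z (n i)| < delta ->
          forall nu : 'rV[R]_J, unit_inward_normal B z nu ->
            dot nu (d i) = 0]) ->
  forall R0 : R, 0 < R0 ->
  exists (L : R) (g : 'rV[R]_J -> R),
    [/\ C2_on (interior G `|` U) g,
        supp g `<=` nbhd_set R0 V,
        exists (theta r : R),
          [/\ 0 < theta, 0 < r < R0,
              forall x u, U x -> d1 x u -> 0 <= dot (grad g x) u &
              forall x u, (U `&` nbhd_set r V) x -> d1 x u ->
                theta <= dot (grad g x) u] &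
        forall x, (interior G `|` U) x ->
          Num.max `|g x| (enorm (grad g x)) <= L /\
          2^-1 * (\sum_(i < J) \sum_(j < J) `|partial i (partial j g) x|)
            <= L / dist_set x V].
Proof.
move=> esp _ V0 [B [delta [[cptB cvxB _ B0] delta0 Bnd]]] R0 R0_gt0.
have [n1 dn _] := esp.
have nle i : `|n i| <= 1 by rewrite -(n1 i) norm_le_enorm.
pose N : R := J.+1%:R; have N1 : 1 <= N by rewrite ler1n.
have N0 : 0 < N by lra.
have JN : J%:R <= N by rewrite ler_nat leqnSn.
have enormN (x : 'rV[R]_J) : enorm x <= N * `|x|.
  by rewrite (le_trans (enorm_le_norm x))// ler_wpM2r.
(* The radius of the support in the maximum norm will be 7/2 times [alpha], and
   [N] bounds the ratio of the Euclidean norm to the maximum norm. *)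
pose alpha := R0 / (8 * N).
have alpha0 : 0 < alpha by rewrite divr_gt0// mulr_gt0.
have Nalpha : N * alpha = R0 / 8 by rewrite /alpha; field; rewrite gt_eqF.
have alphaN : alpha <= N * alpha by rewrite ler_peMl// ltW.
have lo0 : 0 < alpha / 2 by rewrite divr_gt0.
have [f [F1 [F2 [theta [jf theta0 [fb F1b F2b] [f0 F10 F20] grow]]]]] :=
  pushed_smooth nle lo0 (cone_shell_pushed esp V0 cptB cvxB (interior_subset B0)
    delta0 Bnd alpha0).
set b := 3 * alpha + alpha / 2 in fb F1b F2b.
have b0 : 0 < b by rewrite /b; lra.
pose g := dsum b 2^-1 f.
have gP := dsum_partials b0 jf fb F1b F2b; rewrite -/g /= in gP.
have xdom x : (interior G `|` U) x -> x != 0.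
  move=> [Gx|[_ nVx]]; apply/eqP => x0.
    have : V 0 by rewrite V0.
    by move=> [[_ nG] _]; apply: nG; rewrite -x0.
  by apply: nVx; rewrite -/V V0.
have dV x : dist_set x V = enorm x by rewrite V0 dist_set_origin.
have gradE x u : x != 0 -> dot (grad g x) u = dsum b 1 (fun z => lform (F1 ^~ z) u) x.
  move=> x0; have [_ _ p1 _ _] := gP x x0.
  rewrite -lform_dsum lform_dot; congr dot.
  by apply/rowP => k; rewrite !mxE p1.
have lsupp u : supported b (fun z => lform (F1 ^~ z) u).
  by move=> z bz; rewrite /lform big1// => k _; rewrite F1b// mulr0.
(* Dilations preserve the hyperplanes, so all dyadic scales have the same sign. *)
have face x i j : dot x (n i) = 0 -> dot (2 ^+ j *: x) (n i) = 0.
  by move=> xi; rewrite dotZl xi mulr0.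
have push x i j : x != 0 -> dot x (n i) = 0 ->
    0 <= lform (F1 ^~ (2 ^+ j *: x)) (d i) <= dot (grad g x) (d i).
  move=> x0 xi; have lf0 m := proj1 (grow i _ (face x i m xi)).
  rewrite lf0 gradE//=.
  exact: (@dsum_ge _ _ _ (fun z => lform (F1 ^~ z) (d i))).
(* A unit reflection direction has coefficients of total weight at least [M^-1]. *)
pose M := N * (1 + \sum_i `|d i|).
have S0 : 0 <= \sum_i `|d i| by apply: sumr_ge0.
have M0 : 0 < M by rewrite mulr_gt0//; lra.
have reflected x u : U x -> d1 x u -> exists a : 'I_I -> R,
    [/\ forall i, 0 <= a i, u = \sum_(i | active n (fun=> 0) x i) a i *: d i &
        M^-1 <= \sum_(i | active n (fun=> 0) x i) a i].
  move=> [[_ nix] _] [[[]//|[_ [a a0 ua]]] u1]; exists a; split => //.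
  rewrite -[M^-1]mul1r ler_pdivrMr//.
  have -> : 1 = enorm u by rewrite u1.
  rewrite (le_trans (enormN u))// /M mulrCA ler_wpM2l ?(ltW N0)// ua.
  rewrite (le_trans (ler_norm_sum _ _ _))// mulr_suml ler_sum// => i _.
  rewrite normrZ ger0_norm// ler_wpM2l// (bigD1 i)//= addrCA lerDl addr_ge0//.
  exact: sumr_ge0.
have [K0 fK] := jet2_lip0 jf; have [K1 F1K] := jet2_lip1 jf.
have [K2 F2K] := jet2_lip2 jf.
pose L0 := `|K0| * (2 * b); pose L1 := N * (`|K1| * (2 * b)).
pose L2 := N * (N * (N * (`|K2| * b * (2 * b)))).
have bb0 : 0 <= 2 * b by rewrite mulr_ge0// ltW.
have L00 : 0 <= L0 by rewrite mulr_ge0.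
have L10 : 0 <= L1 by rewrite !mulr_ge0// ltW.
have L20 : 0 <= L2 by rewrite !mulr_ge0// ltW.
exists (L0 + L1 + L2), g; split.
- exists [set x | x != 0]; split => [|x /xdom//|x x0].
    rewrite openE => x x0.
    by apply: (@cvgr_neq0 _ _ _ (nbhs x) _ idfun x).
  by have [? ? _ _ ?] := gP x x0.
- move=> x gx; rewrite /nbhd_set /= dV.
  have xb : `|x| <= b.
    have clb : closed [set y : 'rV[R]_J | `|y| <= b].
      apply: (@closed_comp _ _ (fun y : 'rV[R]_J => `|y|) [set t | t <= b]).
        by move=> y _; exact: norm_continuous.
      exact: closed_le.
    apply: clb; apply: closure_subset gx => y /=; apply: contra_neqT.
    by rewrite -ltNge => /ltW; exact: dsum_outside.
  rewrite (le_trans (enormN x))// (le_trans (ler_wpM2l (ltW N0) xb))//.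
  by rewrite /b; lra.
- exists (theta / M), alpha; split.
  + by rewrite divr_gt0.
  + by rewrite alpha0 /=; lra.
  + move=> x u Ux xu; have x0 : x != 0 by apply: xdom; right.
    have [a [a0 -> _]] := reflected x u Ux xu.
    rewrite dot_sumr; apply: sumr_ge0 => i /eqP xi; rewrite dotZr mulr_ge0//.
    by have /andP[h1 h2] := push x i 0%N x0 xi; exact: le_trans h2.
  + move=> x u [Ux]; rewrite /nbhd_set /= dV => xa xu.
    have x0 : x != 0 by apply: xdom; right.
    have [a [a0 -> Ma]] := reflected x u Ux xu.
    have [j xj] := dyadic_shell x0 alpha0 (le_trans (norm_le_enorm x) xa).
    rewrite mulrC; apply: (le_trans (ler_wpM2r (ltW theta0) Ma)).
    rewrite dot_sumr mulr_suml; apply: ler_sum => i /eqP xi.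
    rewrite dotZr ler_wpM2l//.
    have /andP[_ ] := push x i j x0 xi; apply: le_trans.
    have [_ ->//] := grow i _ (face x i j xi).
    split => //; apply: boundary_cone_scale; first by rewrite exprn_gt0.
    by have [] := Ux.
- move=> x /xdom x0; have [_ _ p1 p2 _] := gP x x0.
  have nx : 0 < `|x| by rewrite normr_gt0.
  have ex : 0 < enorm x by rewrite (lt_le_trans nx)// norm_le_enorm.
  have absK K (h : 'rV[R]_J -> R) : lip K h -> lip `|K| h by apply: lip_le; exact: ler_norm.
  split.
    rewrite ge_max; apply/andP; split.
      apply: (@le_trans _ _ L0); last by rewrite -addrA lerDl addr_ge0.
      apply: dsum_le => //; first exact: absK.
      by rewrite ger0_norm ?invr_ge0// invf_le1// ler1n.
    apply: (@le_trans _ _ L1); last by rewrite addrAC lerDr addr_ge0.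
    rewrite (le_trans (enormN _))// ler_wpM2l ?(ltW N0)//.
    apply: norm_le_coord => [|k]; first by rewrite mulr_ge0.
    rewrite mxE p1; apply: dsum_le => //; first exact: absK.
    by rewrite normr1.
  rewrite dV; apply: (@le_trans _ _ (L2 / enorm x)); last first.
    by rewrite ler_wpM2r ?invr_ge0 ?(ltW ex)// lerDr addr_ge0.
  pose c := `|K2| * b * (2 * b) / `|x|.
  have c0 : 0 <= c by rewrite divr_ge0// !mulr_ge0// ltW.
  have sumc : \sum_(i < J) \sum_(j < J) `|partial i (partial j g) x| <= N * (N * c).
    apply: (@le_trans _ _ (\sum_(i < J) \sum_(j < J) c)).
      apply: ler_sum => i _; apply: ler_sum => j _; rewrite p2.
      by apply: dsum2_le => //; exact: absK.
    rewrite !sumr_const card_ord -mulrnA -mulr_natl natrM mulrA.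
    by rewrite ler_wpM2r// ler_pM.
  have s0 : 0 <= \sum_(i < J) \sum_(j < J) `|partial i (partial j g) x|.
    by apply: sumr_ge0 => i _; apply: sumr_ge0.
  apply: (@le_trans _ _ (N * (N * c))); first lra.
  pose C := `|K2| * b * (2 * b); have C0 : 0 <= C by rewrite !mulr_ge0// ltW.
  have cC : c <= N * C / enorm x.
    rewrite /c -/C ler_pdivlMr// mulrAC ler_pdivrMr//.
    by have := ler_wpM2l C0 (enormN x); lra.
  rewrite /L2 -/C -!(mulrA N) !ler_wpM2l ?(ltW N0)//.
  by rewrite mulrA.
Qed.
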